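(* Let $\mathbb K$ be a field, let $G=([n],E(G))$ be a simple graph, let $\mathcal S=(S_{ij})$ be a family of gain sets on $G$ with values in $\mathbb K$, and let $\mathcal A(G_{\mathcal S})$ be the associated affine arrangement in $\mathbb K^n$, with cone $c\mathcal A(G_{\mathcal S})$ and hyperplane at infinity $H_\infty$. Assume that $G$ is a block. Then the following statements are equivalent. (1) The cone $c\mathcal A(G_{\mathcal S})$ is supersolvable. (2) The lattice $L(c\mathcal A(G_{\mathcal S}))$ has a maximal modular chain passing through $H_\infty$. (3) The affine arrangement $\mathcal A(G_{\mathcal S})$ admits a nice partition. (4) $G_{\mathcal S}$ admits an $\mathcal S$-admissible ordering.
   Context: Gain sets: $\mathcal S=(S_{ij})$ is a family of finite subsets of $\mathbb K$ indexed by ordered pairs of distinct vertices of $G$, with $S_{ji}=-S_{ij}=\{-a\mid a\in S_{ij}\}$ and $S_{ij}\neq\emptyset$ if and only if $ij\in E(G)$. $G_{\mathcal S}$ denotes $G$ together with these sets. Put $H_{ij}^a=\{x\in\mathbb K^n\mid x_i-x_j=a\}$ and $\mathcal A(G_{\mathcal S})=\{H_{ij}^a\mid a\in S_{ij},\ i<j\}$. Cone: with an extra coordinate $y$, $c\mathcal A(G_{\mathcal S})=\{cH_{ij}^a\mid a\in S_{ij},\ i<j\}\cup\{H_\infty\}$ in $\mathbb K^{n+1}$, where $cH_{ij}^a=\{(x,y)\mid x_i-x_j=ay\}$ and $H_\infty=\{y=0\}$ is the hyperplane at infinity. Block: ''$G$ is a block'' means that $G$ is connected and has no cut vertex; the one-vertex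 graph and the graph consisting of a single edge are included. Admissible ordering: for $A,B\subseteq\mathbb K$ put $A-B=\{a-b\mid a\in A,b\in B\}$. An ordering $v_1,\dots,v_n$ of the vertices is $\mathcal S$-admissible if $S_{v_kv_j}-S_{v_kv_i}\subseteq S_{v_iv_j}$ for every $k$ and all distinct $i,j>k$. Intersection poset: for a finite affine arrangement $\mathcal A$ in $V$, $L(\mathcal A)$ consists of $V$ and all nonempty intersections of hyperplanes of $\mathcal A$, ordered by reverse inclusion; $r(X)=\operatorname{codim}_V X$; the localization at $X\in L(\mathcal A)$ is $\mathcal A_X=\{H\in\mathcal A\mid X\subseteq H\}$. $\mathcal A$ is central if the intersection of all its hyperplanes is nonempty; then $L(\mathcal A)$ is a ranked lattice with maximum $\hat 1=\bigcap_{H\in\mathcal A}H$. Modularity: for central $\mathcal A$, $X\in L(\mathcal A)$ is modular if $r(X)+r(Y)=r(X\wedge Y)+r(X\vee Y)$ for all $Y\in L(\mathcal A)$. A maximal modular chain is a maximal chain $V=X_0<X_1<\cdots<X_r=\hat 1$ in $L(\mathcal A)$ all of whose elements are modular; it passes through a hyperplane $H\in\mathcal A$ if $X_1=H$. $\mathcal A$ is supersolvable if $L(\mathcal A)$ has a maximal modular chain. Nice partition: let $\pi=(\pi_1,\dots,\pi_s)$ be a partition of an affine arrangement $\mathcal A$ in $V$. A $p$-section of $\pi$ is a set $\{H_1,\dots,H_p\}\subseteq\mathcal A$ no two of whose members lie in the same part; it is independent if $H_1\cap\cdots\cap H_p$ is nonempty of codimension $p$. $\pi$ is independent if every section is independent.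 $\pi$ is nice if it is independent and, for every $X\in L(\mathcal A)\setminus\{V\}$, there is $i$ with $|\pi_i\cap\mathcal A_X|=1$. The empty partition of the empty arrangement is nice. *)

(* Defs.v *)
From mathcomp Require Import all_boot all_order all_fingroup all_algebra.
From mathcomp Require Import finmap.
From mathcomp Require Import boolp classical_sets functions cardinality.

Set Implicit Arguments.
Unset Strict Implicit.
Unset Printing Implicit Defensive.

Import GRing.Theory.
Local Open Scope classical_set_scope.
Local Open Scope card_scope.
Local Open Scope ring_scope.

Section Arrangements.
Variables (K : fieldType) (V : vectType K).
Implicit Types (A B : set (set V)) (X Y Z H : set V).

(* Only meaningful on affine subspaces p + W; the value is 0 elsewhere. *)
Definition codim X : nat :=
  xget 0%N [set r | exists (p : V) (W : {vspace V}),
    X = [set x | x - p \in W] /\ r = (\dim {:V} - \dim W)%N].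

Lemma codim_affine (p : V) (W : {vspace V}) :
  codim [set x | x - p \in W] = (\dim {:V} - \dim W)%N.
Proof.
apply: xget_unique; first by exists p, W.
move=> _ [q [U [eqX ->]]]; congr (_ - \dim _)%N.
have inE x : (x - p \in W) = (x - q \in U).
  by move/(congr1 (fun X => X x)): eqX; rewrite /= propeqE => h; apply/idP/idP => /h.
have pU : p - q \in U by rewrite -inE subrr mem0v.
apply/vspaceP => x; have := inE (x + p).
by rewrite addrK -addrA rpredDr.
Qed.

(* [B = set0] gives the ambient space. *)
Definition flats A : set (set V) :=
  [set X | X !=set0 /\ exists2 B, B `<=` A & X = \bigcap_(H in B) H].

Definition localization A X : set (set V) := [set H | A H /\ X `<=` H].

(* [flats A] is ordered by reverse inclusion: [X] is below [Y] iff [Y `<=` X]. *)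
Definition is_meet A X Y Z :=
  [/\ flats A Z, X `<=` Z, Y `<=` Z &
      forall W, flats A W -> X `<=` W -> Y `<=` W -> Z `<=` W].

Definition is_join A X Y Z :=
  [/\ flats A Z, Z `<=` X, Z `<=` Y &
      forall W, flats A W -> W `<=` X -> W `<=` Y -> W `<=` Z].

Definition modular A X :=
  flats A X /\
  forall Y, flats A Y -> exists M J,
    [/\ is_meet A X Y M, is_join A X Y J &
        (codim X + codim Y = codim M + codim J)%N].

(* Only the values [C 0], ..., [C r] matter. *)
Definition maximal_chain A (r : nat) (C : nat -> set V) :=
  [/\ C 0%N = [set: V],
      C r = \bigcap_(H in A) H,
      (forall i, (i <= r)%N -> flats A (C i)),
      (forall i, (i < r)%N -> C i.+1 `<` C i) &
      forall Z, flats A Z ->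
        (forall i, (i <= r)%N -> Z `<=` C i \/ C i `<=` Z) ->
        exists2 i, (i <= r)%N & Z = C i].

Definition maximal_modular_chain A (r : nat) (C : nat -> set V) :=
  maximal_chain A r C /\ forall i, (i <= r)%N -> modular A (C i).

Definition chain_through (r : nat) (C : nat -> set V) H :=
  (0 < r)%N /\ C 1%N = H.

Definition central A := \bigcap_(H in A) H !=set0.

Definition supersolvable A :=
  central A /\ exists r C, maximal_modular_chain A r C.

Section Partitions.
Variables (A : set (set V)) (s : nat) (pi : 'I_s -> set (set V)).

Definition is_section (p : nat) B :=
  [/\ B `<=` A, B #= `I_p &
      forall i H H', B H -> B H' -> pi i H -> pi i H' -> H = H'].

Definition independent_section (p : nat) B :=
  \bigcap_(H in B) H !=set0 /\ codim (\bigcap_(H in B) H) = p.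

Definition independent_partition :=
  forall p B, is_section p B -> independent_section p B.

Definition nice_partition :=
  [/\ partition [set: 'I_s] pi A,
      independent_partition &
      forall X, flats A X -> X <> [set: V] ->
        exists i, pi i `&` localization A X #= `I_1].

End Partitions.
End Arrangements.

Section Graphs.
Variable T : finType.

Definition simple_graph (e : rel T) := symmetric e /\ irreflexive e.

Definition connected_graph (e : rel T) := forall x y, connect e x y.

Definition delete_vertex (e : rel T) (v : T) : rel T :=
  [rel x y | [&& e x y, x != v & y != v]].

Definition cut_vertex (e : rel T) (v : T) :=
  exists x y, [/\ x != v, y != v, connect e x y &
                  ~~ connect (delete_vertex e v) x y].

Definition is_block (e : rel T) :=
  connected_graph e /\ forall v, ~ cut_vertex e v.

End Graphs.

Section GainGraphs.
Variables (K : fieldType) (n : nat).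
Implicit Type S : 'I_n -> 'I_n -> {fset K}.

(* The diagonal values [S i i] are unconstrained and never used below. *)
Definition gain_sets (e : rel 'I_n) S :=
  forall i j, i != j ->
    S j i = [fset - a | a in S i j]%fset /\ (S i j != fset0 <-> e i j).

Definition gain_hyperplane (i j : 'I_n) (a : K) : set 'rV[K]_n :=
  [set x | x 0 i - x 0 j = a].

Definition gain_arrangement S : set (set 'rV[K]_n) :=
  [set H | exists (i j : 'I_n) (a : K),
    [/\ (i < j)%N, a \in S i j & H = gain_hyperplane i j a]].

(* A point (x, y) of the cone is [row_mx x y]. *)
Definition cone_hyperplane (i j : 'I_n) (a : K) : set 'rV[K]_(n + 1) :=
  [set z | lsubmx z 0 i - lsubmx z 0 j = a * rsubmx z 0 0].

Definition hyperplane_at_infinity : set 'rV[K]_(n + 1) :=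
  [set z | rsubmx z 0 0 = 0].

Definition cone_arrangement S : set (set 'rV[K]_(n + 1)) :=
  [set H | exists (i j : 'I_n) (a : K),
    [/\ (i < j)%N, a \in S i j & H = cone_hyperplane i j a]]
  `|` [set hyperplane_at_infinity].

Definition admissible_ordering S (v : {perm 'I_n}) :=
  forall k i j : 'I_n, (k < i)%N -> (k < j)%N -> i != j ->
    ([fset b - a | b in S (v k) (v j), a in S (v k) (v i)]
       `<=` S (v i) (v j))%fset.

End GainGraphs.

Arguments hyperplane_at_infinity {K n}.

(* Main.v *)
Require Import Defs.
From HB Require Import structures.
From mathcomp Require Import all_boot all_order all_fingroup all_algebra.
From mathcomp Require Import finmap.
From mathcomp Require Import boolp classical_sets functions cardinality.
From mathcomp Require Import zify ring.

(** Every condition is compared with the existence of an admissible ordering.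

    A maximal modular chain has an exchange property: two hyperplanes [H1], [H2]
    that enter the chain at the same step meet inside a third hyperplane [H3]
    that entered before ([modular_chain_exchange]).  In a gain arrangement this
    is very restrictive.  The intersection of the hyperplanes of two disjoint
    edges lies in no third one, and for adjacent edges [ij] and [jk] with gains
    [a] and [b] the only third one is that of the edge [ik] with gain [a + b].
    So the edges that enter at one step pairwise share a vertex, and in a block
    they are exactly the edges at one vertex [c] ([crossing_star]).  If the
    hyperplane at infinity is already present, then [c] satisfies the first
    condition of an admissible ordering; removing [c] leaves a block, because
    the neighbours of [c] form a clique, and the argument is repeated down the
    chain.  If the hyperplane at infinity enters at the current step, then all
    edges carry a gain coming from a potential, the remaining chain gives a
    perfect elimination ordering of the graph ([balanced_elimination]), and the
    gains not coming from the potential are confined to a clique.  A perfect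
    elimination ordering can be made to end with any given clique, and with the
    vertices of that clique in the right order it is admissible
    ([nearly_balanced_elimination]).

    Conversely, an admissible ordering gives a chain starting with the
    hyperplane at infinity: intersect it with the hyperplanes among the last
    [k] vertices.  Each of these flats is modular because a point that satisfies
    the equations of a flat [Y] among the last vertices extends to a point of
    [Y], one earlier vertex after another ([tail_extension]).  It also gives a
    nice partition, by grouping the hyperplanes by the earlier endpoint of their
    edge ([first_vertex_nice]).

    Finally, the parts of a nice partition colour the edges of the graph.
    Independence of the partition forbids closed walks with pairwise distinct
    colours ([no_rainbow_walk]), and looking at the flats of codimension two
    shows that every colour class is a star whose leaves form a clique with
    the required gains ([adjacent_edges_colour]).  In a block such a colouring
    has a vertex all of whose edges have one colour ([monochromatic_vertex]);
    it can be listed first, and induction applies to the rest. *)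

Set Implicit Arguments.
Unset Strict Implicit.
Unset Printing Implicit Defensive.

Import GRing.Theory.
Local Open Scope ring_scope.

(** * Blocks and simplicial vertices *)

Section Blocks.
Variables (T : finType) (e : rel T).
Hypothesis e_simple : simple_graph e.
Implicit Types (U W : {set T}) (c i j k l v x y z : T) (s t : seq T).

Let e_sym x y : e x y -> e y x.
Proof. by case: e_simple => ->. Qed.

Let e_irr x : e x x = false.
Proof. by case: e_simple => _ ->. Qed.

Definition induced W : rel T := [rel x y | [&& e x y, x \in W & y \in W]].

Definition connected_on W := forall x y, x \in W -> y \in W -> connect (induced W) x y.

Definition block_on U := connected_on U /\ forall v, v \in U -> connected_on (U :\ v).

Definition simplicial c U :=
  forall i j, i \in U -> j \in U -> i != j -> e c i -> e c j -> e i j.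

Lemma block_onT : is_block e -> block_on [set: T]%SET.
Proof.
move=> [conn ncut]; split=> [x y _ _|v _ x y].
  rewrite (eq_connect (e' := e)); first exact: conn.
  by move=> u w; rewrite /induced /= !inE !andbT.
rewrite !inE !andbT => xv yv; apply: contrapT => /negP nxy.
apply: (ncut v); exists x, y; split=> //.
rewrite (eq_connect (e' := induced ([set: T]%SET :\ v))) //.
by move=> u w; rewrite /induced /= !inE !andbT.
Qed.

Lemma connected_on_edge W x y : connected_on W -> x \in W -> y \in W -> x != y ->
  exists2 z, z \in W & e x z.
Proof.
move=> cW xW yW; have /connectP [[|z p] /=] := cW x y xW yW.
  by move=> _ ->; rewrite eqxx.
by move=> /andP [/and3P [exz _ zW] _] _ _; exists z.
Qed.

(** A walk through a simplicial vertex can be shortcut between the two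
    neighbours it uses there. *)
Lemma connected_on_remove W c : connected_on W -> simplicial c W ->
  connected_on (W :\ c).
Proof.
move=> cW sc x y; rewrite !inE => /andP [xc xW] /andP [yc yW].
have /connectP [p ep ey] := cW x y xW yW.
suff : (x != c -> connect (induced (W :\ c)) x y) /\
       (x = c -> forall z, z \in W -> z != c -> e c z -> connect (induced (W :\ c)) z y).
  by case=> /(_ xc).
elim: p x {xc} xW ep ey => [|w p IH] x xW /=.
  by move=> _ yx; split=> xc; [rewrite yx connect0|rewrite yx xc eqxx in yc].
move=> /andP [/and3P [xw _ wW] ep] ey; have [IH1 IH2] := IH w wW ep ey.
split=> [xc|xc z zW zc cz].
  have [wc|wc] := eqVneq w c; first by apply: IH2 => //; rewrite -wc e_sym.
  by apply: connect_trans (IH1 wc); apply: connect1; rewrite /induced /= xw !inE xc xW wc.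
have wc : w != c by rewrite -xc; apply: contraTneq xw => ->; rewrite e_irr.
have [->|zw] := eqVneq z w; first exact: IH1.
apply: connect_trans (IH1 wc); apply: connect1; rewrite /induced /= !inE zc zW wc wW !andbT.
by apply: sc => //; rewrite -xc.
Qed.

Lemma block_on_remove U c : block_on U -> c \in U -> simplicial c U -> block_on (U :\ c).
Proof.
move=> [_ cU] cU1 sc; split=> [|v]; first exact: cU.
rewrite !inE => /andP [vc vU].
have -> : U :\ c :\ v = U :\ v :\ c by apply/setP => x; rewrite !inE andbCA.
apply: connected_on_remove; first exact: cU.
by move=> i j; rewrite !inE => /andP [_ iU] /andP [_ jU]; apply: sc.
Qed.

(** The edges of a block that leave the classes of an equivalence relation
    (called crossing) form a cut.  If no two crossing edges are disjoint and
    they form no triangle, they all pass through one vertex [c].  As the rest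
    of the block stays connected after removing [c], it lies in a single class,
    so the crossing edges are exactly the edges at [c]. *)
Lemma crossing_star U (eqv : T -> T -> Prop) :
  (forall x, eqv x x) -> (forall x y, eqv x y -> eqv y x) ->
  (forall y x z, eqv x y -> eqv y z -> eqv x z) ->
  block_on U ->
  (forall i j k l, i \in U -> j \in U -> k \in U -> l \in U -> uniq [:: i; j; k; l] ->
     e i j -> e k l -> eqv i j \/ eqv k l) ->
  (forall i j k, i \in U -> j \in U -> k \in U -> uniq [:: i; j; k] ->
     e i j -> e j k -> ~ eqv i j -> ~ eqv j k -> eqv i k) ->
  (forall i j, i \in U -> j \in U -> e i j -> eqv i j) \/
  exists c, [/\ c \in U,
    forall i j, i \in U :\ c -> j \in U :\ c -> e i j -> eqv i j &
    forall i, i \in U -> e c i -> ~ eqv c i].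
Proof.
move=> er es et [_ bU] disj adj.
have neq_edge i j : e i j -> i != j by move=> ij; apply: contraTneq ij => ->; rewrite e_irr.
pose cross i j := [/\ i \in U, j \in U, e i j & ~ eqv i j].
have crossC i j : cross i j -> cross j i.
  by case=> iU jU ij nij; split=> //; [exact: e_sym|move=> /es].
have [[x [y xy]]|none] := pselect (exists x y, cross x y); last first.
  by left=> i j iU jU ij; apply: contrapT => nij; apply: none; exists i, j.
right.
have meet i j k l : cross i j -> cross k l -> i != k -> i != l -> j = k \/ j = l.
  move=> [iU jU ij nij] [kU lU kl nkl] ik il.
  have [jk|jk] := eqVneq j k; [by left|]; have [jl|jl] := eqVneq j l; [by right|].
  have un : uniq [:: i; j; k; l].
    by rewrite /= !inE !negb_or ik il jk jl (neq_edge _ _ ij) (neq_edge _ _ kl).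
  by case: (disj i j k l iU jU kU lU un ij kl).
have [c cc] : exists c, forall i j, cross i j -> i = c \/ j = c.
  have [allx|] := pselect (forall i j, cross i j -> i = x \/ j = x); first by exists x.
  move=> /existsNP [u /existsNP [w /not_implyP [uw /not_orP [ux wx]]]].
  have [z yz zx] : exists2 z, cross y z & z != x.
    have [yu|yw] := meet _ _ _ _ xy uw (introN eqP (nesym ux)) (introN eqP (nesym wx)).
      by exists w; [rewrite yu|apply/eqP].
    by exists u; [rewrite yw; apply: crossC|apply/eqP].
  exists y => i j ij; apply: contrapT => /not_orP [iy jy].
  have xin : i = x \/ j = x.
    have := meet _ _ _ _ (crossC _ _ xy) ij (introN eqP (nesym iy)) (introN eqP (nesym jy)).
    by case=> ->; [left|right].
  have zin : i = z \/ j = z.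
    have := meet _ _ _ _ yz ij (introN eqP (nesym iy)) (introN eqP (nesym jy)).
    by case=> ->; [left|right].
  have nxz : ~ eqv x z.
    have xz : cross x z.
      case: xin zin => [ix|jx] [iz|jz]; first by rewrite -iz ix eqxx in zx.
      - by rewrite -ix -jz.
      - by apply: crossC; rewrite -jx -iz.
      - by rewrite -jz jx eqxx in zx.
    by case: xz.
  have [xU yU exy nxy] := xy; have [_ zU eyz nyz] := yz.
  apply: nxz; apply: (adj x y z) => //.
  by rewrite /= !inE negb_or (neq_edge _ _ exy) (neq_edge _ _ eyz) eq_sym zx.
have [l cl] : exists l, cross c l.
  by case: (cc _ _ xy) => <-; [exists y|exists x; apply: crossC].
have [cU lU ecl ncl] := cl.
have lc : l != c by rewrite eq_sym neq_edge.
have inner i j : i \in U :\ c -> j \in U :\ c -> e i j -> eqv i j.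
  rewrite !inE => /andP [ic iU] /andP [jc jU] ij; apply: contrapT => nij.
  have cij : cross i j by split.
  by case: (cc _ _ cij) => eqc; rewrite eqc eqxx in ic jc.
exists c; split=> // i iU ci nci; apply: ncl; apply: (et i) => //.
have ic : i != c by rewrite eq_sym neq_edge.
have /connectP [p ep ->] : connect (induced (U :\ c)) i l by apply: bU; rewrite // !inE ?ic ?lc.
elim: p {ci nci iU ic} i ep => [|w p IH] i /=; first by move=> _; exact: er.
by move=> /andP [/and3P [iw iU wU] ep]; apply: (et w); [exact: inner|exact: IH].
Qed.

(** * Elimination orderings *)

(** Perfect elimination orderings and admissible orderings are both of this
    shape.  Lists are more convenient than permutations here: they restrict to
    sets of vertices, and a removed vertex is put back in front. *)
Fixpoint elimination (R : T -> T -> T -> Prop) s : Prop :=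
  if s is c :: s' then
    (forall i j, i \in s' -> j \in s' -> i != j -> R c i j) /\ elimination R s'
  else True.

Definition simplicial_rel c i j := e c i -> e c j -> e i j.

Lemma elimination_subseq R s t : subseq s t -> elimination R t -> elimination R s.
Proof.
elim: t s => [|y t IH] [|x s] //=; case: eqP => [<- sub|_ sub] [Ry Rt]; last exact: (IH (x :: s)).
split; last exact: IH.
by move=> i j /(mem_subseq sub) it /(mem_subseq sub) jt; apply: Ry.
Qed.

Lemma elimination_cat (R R' : T -> T -> T -> Prop) s t :
  elimination R' (s ++ t) -> uniq (s ++ t) -> elimination R t ->
  (forall c i j, c \in s -> i \in s ++ t -> j \in s ++ t -> uniq [:: c; i; j] ->
     R' c i j -> R c i j) ->
  elimination R (s ++ t).
Proof.
elim: s => //= c s IH [R'c R's] /andP [cs us] Rt impl; split; last first.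
  by apply: IH => // x i j xs iS jS; apply: impl; rewrite inE ?xs ?iS ?jS orbT.
move=> i j iS jS ij; apply: impl; rewrite ?inE ?eqxx ?iS ?jS ?orbT //; last exact: R'c.
rewrite /= ?inE negb_or ij !andbT.
by apply/andP; split; [apply: contraNneq cs => ->|apply: contraNneq cs => ->].
Qed.

(** If the first vertex [c] lies in the clique, its later neighbours form a
    clique too; a simplicial vertex of the rest outside that clique is not
    adjacent to [c], so it stays simplicial, and it lies outside the given
    clique. *)
Lemma simplicial_outside_clique s (Q : pred T) :
  uniq s -> elimination simplicial_rel s ->
  (forall x y, x \in s -> y \in s -> x != y -> Q x -> Q y -> e x y) ->
  (exists2 x, x \in s & ~~ Q x) ->
  exists w, [/\ w \in s, ~~ Q w &
    forall i j, i \in s -> j \in s -> i != j -> simplicial_rel w i j].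
Proof.
elim: s Q => [|c s IH] Q /=; first by move=> _ _ _ [].
move=> /andP [cs us] [sc es] clQ [x xs Qx].
have [Qc|Qc] := boolP (Q c); last first.
  exists c; split; rewrite ?inE ?eqxx // => i j; rewrite !inE.
  have [->|_] := eqVneq i c; first by move=> _ _ _; rewrite /simplicial_rel e_irr.
  have [->|_] := eqVneq j c; first by move=> _ _ _; rewrite /simplicial_rel e_irr.
  exact: sc.
have [far|near] := pselect (exists2 y, y \in s & ~~ e c y).
  have [|w [ws ncw sw]] := IH (e c) us es _ far.
    by move=> y z ys zs yz; apply: sc.
  have wc : w != c by apply: contraNneq cs => <-.
  exists w; split; [by rewrite inE ws orbT| |].
    apply: contra ncw => Qw; apply: clQ; rewrite ?inE ?eqxx ?ws ?orbT //.
    by rewrite eq_sym.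
  have new : e w c = false by apply/negP => /e_sym; apply/negP.
  move=> i j; rewrite !inE.
  have [->|_] := eqVneq i c; first by move=> _ _ _; rewrite /simplicial_rel new.
  have [->|_] := eqVneq j c; first by move=> _ _ _; rewrite /simplicial_rel new.
  exact: sw.
have adjc y : y \in s -> e c y.
  by move=> ys; apply: contrapT => /negP ncy; apply: near; exists y.
exists x; split=> // i j; rewrite !inE.
have [->|_] := eqVneq i c => /=.
  by have [->|_] := eqVneq j c; [|move=> _ js _ _ _; apply: adjc].
have [->|_] := eqVneq j c => /=; first by move=> iS _ _ _ _; apply: e_sym; apply: adjc.
by move=> iS jS ij _ _; apply: sc => //; apply: adjc.
Qed.

Lemma elimination_clique s :
  (forall x y, x \in s -> y \in s -> x != y -> e x y) -> elimination simplicial_rel s.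
Proof.
elim: s => //= c s IH cl; split; last first.
  by apply: IH => x y xs ys; apply: cl; rewrite inE ?xs ?ys orbT.
by move=> i j iS jS ij _ _; apply: cl; rewrite ?inE ?iS ?jS ?orbT.
Qed.

Lemma clique_eliminated_last s (q : seq T) :
  elimination simplicial_rel s -> uniq s -> uniq q -> {subset q <= s} ->
  (forall x y, x \in q -> y \in q -> x != y -> e x y) ->
  exists t, perm_eq (t ++ q) s /\ elimination simplicial_rel (t ++ q).
Proof.
move sz : (size s) => m; elim: m s sz => [|m IH] s sz es us uq qs clq.
  exists [::]; move/size0nil: sz qs => -> qs; split; last exact: elimination_clique.
  by apply: uniq_perm => // x; apply/negP => /qs.
have [[x xs xq]|all] := pselect (exists2 x, x \in s & x \notin q); last first.
  exists [::]; split; last exact: elimination_clique.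
  apply: uniq_perm => // x; apply/idP/idP => [/qs //|xs].
  by apply: contrapT => xq; apply: all; exists x => //; apply/negP.
have [|w [ws wq sw]] := @simplicial_outside_clique s (mem q) us es _ (ex_intro2 _ _ x xs xq).
  by move=> y z ys zs yz yq zq; apply: clq.
have [||||||t [pt et]] := IH (rem w s).
- by rewrite size_rem ?sz.
- exact: elimination_subseq (rem_subseq _ _) es.
- exact: rem_uniq.
- by [].
- move=> y yq; rewrite mem_rem_uniq // !inE qs // andbT.
  by apply: contraNneq wq => <-.
- exact: clq.
exists (w :: t); split; first by rewrite perm_sym (permPl (perm_to_rem ws)) /= perm_cons perm_sym.
have sub y : y \in t ++ q -> y \in s by rewrite (perm_mem pt) => /mem_rem.
by split=> // i j /sub iS /sub jS; apply: sw.
Qed.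

End Blocks.

Local Open Scope classical_set_scope.

(** * Affine subspaces and codimension *)

Section AffineSets.
Variables (K : fieldType) (V : vectType K).
Implicit Types (A B : set (set V)) (X Y Z H M : set V).

Definition affine_closed X :=
  forall (t : K) x y z, X x -> X y -> X z -> X (x + t *: (y - z)).

Lemma affine_closed_bigcap B :
  (forall H, B H -> affine_closed H) -> affine_closed (\bigcap_(H in B) H).
Proof.
by move=> clB t x y z Xx Xy Xz H BH; apply: (clB H BH); [exact: Xx|exact: Xy|exact: Xz].
Qed.

(** The direction is a subspace of largest dimension among those whose translate
    by [p] lies in [X]: any further point of [X] would enlarge it. *)
Lemma affine_closedE X p : affine_closed X -> X p ->
  exists W : {vspace V}, X = [set x | x - p \in W].
Proof.
move=> clX Xp.
pose P d := `[< exists W : {vspace V}, \dim W = d /\ [set x | x - p \in W] `<=` X >].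
have P0 : exists d, P d.
  exists 0%N; apply/asboolP; exists 0%VS; split; first by rewrite dimv0.
  by move=> x /=; rewrite memv0 subr_eq0 => /eqP ->.
have Pmax d : P d -> (d <= \dim {:V})%N.
  by move=> /asboolP [W [<- _]]; rewrite dimvS // subvf.
have [d /asboolP [W [dW WX]] dmax] := ex_maxnP P0 Pmax.
exists W; apply/seteqP; split=> // x Xx /=; apply: contrapT => /negP xW.
suff : (d.+1 <= d)%N by rewrite ltnn.
apply: dmax; apply/asboolP; exists (W + <[x - p]>)%VS; split.
  have ds : directv (W + <[x - p]>).
    apply/directv_addP/eqP; rewrite -subv0; apply/subvP => y.
    rewrite memv_cap => /andP [yW /vlineP [t yt]].
    have [t0|t0] := eqVneq t 0; first by rewrite yt t0 scale0r mem0v.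
    case/negP: xW; rewrite -[x - p]scale1r -(mulVf t0) -scalerA -yt.
    exact: memvZ.
  move/directvP: ds => /= ->; rewrite dW dim_vline -[X in _ = X]addn1; congr addn.
  case: eqP => // xp; case/negP: xW; by rewrite xp mem0v.
move=> y /= /memv_addP [w wW [u /vlineP [t ->] eqy]].
have -> : y = (w + p) + t *: (x - p) by rewrite -[y](subrK p) eqy addrAC.
by apply: clX => //; apply: WX; rewrite /= addrK.
Qed.

Definition hyperplane_of (f : V -> K) (a : K) : set V := [set x | f x = a].

Definition lin_form (f : V -> K) :=
  forall (t : K) x y, f (t *: x + y) = t * f x + f y.

Lemma lin_form_ker0 f : lin_form f -> f 0 = 0.
Proof.
by move=> lf; have := lf 1 0 0; rewrite scale1r addr0 mul1r -{1}[f 0]addr0 => /addrI.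
Qed.

Lemma lin_formB f x y t z : lin_form f -> f (z + t *: (x - y)) = f z + t * (f x - f y).
Proof.
move=> lf; have lfD u v : f (u + v) = f u + f v by rewrite -[u]scale1r lf mul1r scale1r.
have lfZ s u : f (s *: u) = s * f u by rewrite -[s *: u]addr0 lf lin_form_ker0 // addr0.
by rewrite lfD lfZ lfD -scaleN1r lfZ mulN1r.
Qed.

Lemma affine_closed_hyperplane f a : lin_form f -> affine_closed (hyperplane_of f a).
Proof.
by move=> lf t x y z /= fx fy fz; rewrite /hyperplane_of /= lin_formB // fx fy fz subrr mulr0 addr0.
Qed.

Lemma codimT : codim [set: V] = 0%N.
Proof.
have -> : [set: V] = [set x | x - 0 \in fullv] :> set V.
  by apply/seteqP; split=> x //= _; rewrite memvf.
by rewrite codim_affine subnn.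
Qed.

(** A linear form that is not constant on an affine subspace cuts its
    direction down by exactly one dimension. *)
Lemma codim_cap_hyperplane X f a : affine_closed X -> lin_form f ->
  X `&` hyperplane_of f a !=set0 -> ~ X `<=` hyperplane_of f a ->
  codim (X `&` hyperplane_of f a) = (codim X).+1.
Proof.
move=> clX lf [p [Xp fp]] nXf; have [W XE] := affine_closedE clX Xp.
pose F : {linear V -> K^o} := HB.pack f (GRing.isLinear.Build K V K^o *:%R f lf).
have lE x : linfun F x = f x by rewrite lfunE.
have -> : X `&` hyperplane_of f a = [set x | x - p \in (W :&: lker (linfun F))%VS].
  apply/seteqP; split=> x /=.
    move=> [Xx fx]; rewrite memv_cap memv_ker lE.
    rewrite XE /= in Xx; rewrite Xx /= /hyperplane_of /= in fx *.
    have := lin_formB x p 1 0 lf; rewrite add0r scale1r lin_form_ker0 // add0r mul1r => ->.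
    by rewrite fx fp subrr.
  rewrite memv_cap memv_ker lE => /andP [xW].
  have := lin_formB x p 1 0 lf; rewrite add0r scale1r lin_form_ker0 // add0r mul1r => ->.
  by rewrite subr_eq0 fp => /eqP fx; split; [rewrite XE|].
rewrite codim_affine [in RHS]XE codim_affine.
have dimF : \dim (linfun F @: W) = 1%N.
  apply/eqP; rewrite eqn_leq; apply/andP; split.
    by apply: leq_trans (dimvS (subvf _)) _; rewrite dimvf /dim /=.
  rewrite lt0n dimv_eq0; apply/eqP => F0; apply: nXf => x Xx.
  rewrite /hyperplane_of /=.
  have := lin_formB x p 1 0 lf; rewrite add0r scale1r lin_form_ker0 // add0r mul1r.
  have : linfun F (x - p) \in (linfun F @: W)%VS by apply: memv_img; rewrite XE in Xx.
  by rewrite F0 memv0 lE => /eqP -> /eqP; rewrite eq_sym subr_eq0 fp => /eqP.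
have := limg_ker_dim (linfun F) W; rewrite dimF => dW.
have : (\dim W <= \dim {:V})%N by rewrite dimvS // subvf.
lia.
Qed.

End AffineSets.

(** * Modular flats of a linear arrangement *)

Section LinearArrangements.
Variables (K : fieldType) (V : vectType K).
Implicit Types (A B : set (set V)) (X Y Z H M : set V).

Definition linear_arrangement A :=
  forall H, A H -> exists2 f : V -> K, lin_form f & H = hyperplane_of f 0.

Lemma flat_hyperplane A H : A H -> H !=set0 -> flats A H.
Proof.
move=> AH H0; split=> //; exists [set H]; first by move=> _ ->.
by rewrite bigcap_set1.
Qed.

Lemma flatT A : flats A [set: V].
Proof. by split; [exists 0|exists set0 => //; rewrite bigcap_set0]. Qed.

Lemma flatI A X Y : flats A X -> flats A Y -> X `&` Y !=set0 -> flats A (X `&` Y).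
Proof.
move=> [_ [B BA ->]] [_ [B' BA' ->]] ne; split=> //; exists (B `|` B').
  by move=> H []; [apply: BA|apply: BA'].
by rewrite bigcap_setU.
Qed.

Lemma flat_sub_hyperplane A X : flats A X -> X <> [set: V] ->
  exists2 H, A H & X `<=` H.
Proof.
move=> [_ [B BA ->]] XT; have [H BH] : B !=set0.
  apply/set0P/eqP => B0; apply: XT; by rewrite B0 bigcap_set0.
by exists H; [apply: BA|apply: bigcap_inf].
Qed.

Section Linear.
Variables (A : set (set V)) (linA : linear_arrangement A).

Lemma hyperplane_contains0 H : A H -> H 0.
Proof. by move=> /linA [f lf ->]; exact: lin_form_ker0. Qed.

Lemma flat_contains0 X : flats A X -> X 0.
Proof. by move=> [_ [B BA ->]] H /BA /hyperplane_contains0. Qed.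

Lemma flat_affine_closed X : flats A X -> affine_closed X.
Proof.
move=> [_ [B BA ->]]; apply: affine_closed_bigcap => H /BA /linA [f lf ->].
exact: affine_closed_hyperplane.
Qed.

Lemma flat_vspace X : flats A X -> exists W : {vspace V}, X = [set x | x \in W].
Proof.
move=> XA; have [W ->] := affine_closedE (flat_affine_closed XA) (flat_contains0 XA).
by exists W; apply/seteqP; split=> x /=; rewrite subr0.
Qed.

Lemma linear_flatI X Y : flats A X -> flats A Y -> flats A (X `&` Y).
Proof. by move=> XA YA; apply: flatI => //; exists 0; split; exact: flat_contains0. Qed.

Lemma linear_flat_hyperplane H : A H -> flats A H.
Proof. by move=> AH; apply: flat_hyperplane => //; exists 0; exact: hyperplane_contains0. Qed.

Lemma codim_flat_hyperplane X H : flats A X -> A H -> ~ X `<=` H ->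
  codim (X `&` H) = (codim X).+1.
Proof.
move=> XA AH; have X0 := flat_contains0 XA; have H0 := hyperplane_contains0 AH.
have [f lf eqH] := linA AH; rewrite eqH in H0 *; move=> nXH.
by apply: codim_cap_hyperplane => //; [apply: flat_affine_closed|exists 0].
Qed.

Lemma codim2_hyperplanes H1 H2 : A H1 -> A H2 -> H1 <> [set: V] ->
  H2 <> [set: V] -> H1 <> H2 -> codim (H1 `&` H2) = 2.
Proof.
have codim1 H : A H -> H <> [set: V] -> codim H = 1%N.
  move=> AH HT; rewrite -[H]setTI codim_flat_hyperplane ?codimT //; first exact: flatT.
  by move=> TH; apply: HT; apply/seteqP; split.
move=> A1 A2 T1 T2 neq.
have [le12|n12] := pselect (H1 `<=` H2).
  have n21 : ~ H2 `<=` H1 by move=> le21; apply: neq; apply/seteqP.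
  by rewrite setIC codim_flat_hyperplane ?codim1 //; exact: linear_flat_hyperplane.
by rewrite codim_flat_hyperplane ?codim1 //; exact: linear_flat_hyperplane.
Qed.

Lemma chain_antitone r (C : nat -> set V) :
  maximal_chain A r C -> forall i j, (i <= j <= r)%N -> C j `<=` C i.
Proof.
move=> [_ _ _ dec _] i j /andP [ij jr].
elim: j ij jr => [|j IH] ij jr; first by move: ij; rewrite leqn0 => /eqP ->.
have [->//|ne] := eqVneq i j.+1.
have /dec/properW sub : (j < r)%N by [].
by apply: subset_trans sub _; apply: IH; lia.
Qed.

(** A maximal modular chain has the defining property of a supersolvable
    arrangement in terms of hyperplanes: writing [X = C k], the flat
    [H1 `&` H2] has codimension 2 while [X `&` H1 `&` H2] has codimension only
    one more than [X], so by modularity the meet of [X] and [H1 `&` H2] is a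
    proper flat and lies in a hyperplane. *)
Lemma modular_chain_exchange r C k H1 H2 :
  maximal_modular_chain A r C -> (k < r)%N -> A H1 -> A H2 -> H1 <> H2 ->
  C k.+1 `<=` H1 -> C k.+1 `<=` H2 -> ~ C k `<=` H1 -> ~ C k `<=` H2 ->
  exists H3, [/\ A H3, C k `<=` H3 & H1 `&` H2 `<=` H3].
Proof.
move=> [chC modC] kr A1 A2 neq C1 C2 n1 n2.
have [C0 Cr flC decC maxC] := chC; have antiC := chain_antitone chC.
have flk : flats A (C k) by apply: flC; lia.
have capC : C k `&` H1 `<=` C k.+1.
  have [] := maxC (C k `&` H1).
  - exact: linear_flatI flk (linear_flat_hyperplane A1).
  - move=> i ir; have [ik|ki] := leqP i k.
      by left; move=> x [Cx _]; apply: antiC Cx; lia.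
    right => x Cx; have Ck1 : C k.+1 x by apply: antiC Cx; lia.
    by split; [apply: properW Ck1; exact: decC|apply: C1].
  - move=> i ir eqi; have [ik|ki] := leqP i k; last by rewrite eqi; apply: antiC; lia.
    by case: n1 => x Ckx; have : C i x; [apply: antiC Ckx; lia|rewrite -eqi => -[]].
have flY : flats A (H1 `&` H2) by apply: linear_flatI; exact: linear_flat_hyperplane.
have [_ /(_ _ flY) [M [J [[flM XM YM _] [_ JX JY minJ] rk]]]] := modC k (ltnW kr).
have JE : J = C k `&` H1.
  apply/seteqP; split=> [x Jx|x [Xx Hx]]; first by split; [apply: JX|case: (JY _ Jx)].
  apply: (minJ (C k `&` (H1 `&` H2))); last 1 first.
  - by split=> //; split=> //; apply: C2; apply: capC.
  - exact: linear_flatI.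
  - by move=> y [].
  - by move=> y [].
have nT H : ~ C k `<=` H -> H <> [set: V] by move=> nH HT; apply: nH; rewrite HT.
have MT : M <> [set: V].
  move=> MT; move: rk; rewrite MT codimT JE (codim_flat_hyperplane flk A1 n1).
  rewrite (codim2_hyperplanes A1 A2 (nT _ n1) (nT _ n2) neq); lia.
have [H3 A3 MH] := flat_sub_hyperplane flM MT.
by exists H3; split=> //; [apply: subset_trans XM MH|apply: subset_trans YM MH].
Qed.

(** For linear flats the rank identity says that the sum of subspaces [X + Y]
    is itself a flat, necessarily the meet. *)
Lemma modular_of_sum X : flats A X ->
  (forall Y, flats A Y -> exists M, [/\ flats A M, X `<=` M, Y `<=` M &
     forall z, M z -> exists x y, [/\ X x, Y y & z = x + y]]) ->
  modular A X.
Proof.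
move=> flX sumX; split=> // Y flY; have [M [flM XM YM sumM]] := sumX Y flY.
have [U UE] := flat_vspace flX; have [W WE] := flat_vspace flY.
have flat_sum Z u w : flats A Z -> Z u -> Z w -> Z (u + w).
  by move=> /flat_vspace [T ->] /=; exact: memvD.
have codimE (T : {vspace V}) : codim [set x | x \in T] = (\dim {:V} - \dim T)%N.
  by rewrite -(codim_affine 0); congr codim; apply/seteqP; split=> x /=; rewrite subr0.
have ME : M = [set x | x \in (U + W)%VS].
  apply/seteqP; split=> z /=.
    by move=> /sumM [x [y [Xx Yy ->]]]; apply: memv_add; rewrite ?UE ?WE in Xx Yy.
  move=> /memv_addP [x xU [y yW ->]]; apply: flat_sum => //.
    by apply: XM; rewrite UE.
  by apply: YM; rewrite WE.
have JE : X `&` Y = [set x | x \in (U :&: W)%VS].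
  by rewrite UE WE; apply/seteqP; split=> z /=; rewrite memv_cap => /andP.
exists M, (X `&` Y); split.
- split=> // Z flZ XZ YZ z /sumM [x [y [Xx Yy ->]]].
  by apply: flat_sum => //; [apply: XZ|apply: YZ].
- split; [exact: linear_flatI|by move=> x []|by move=> x []|].
  by move=> Z flZ ZX ZY z Zz; split; [apply: ZX|apply: ZY].
- rewrite ME JE UE WE !codimE; have := dimv_sum_cap U W.
  have dimle (T : {vspace V}) : (\dim T <= \dim {:V})%N by rewrite dimvS // subvf.
  have := dimle U; have := dimle W; have := dimle (U + W)%VS; have := dimle (U :&: W)%VS.
  lia.
Qed.

(** Consecutive members of the chain differ by one linear equation, so no flat
    lies strictly between them. *)
Lemma maximal_chain_of_forms r (C : nat -> set V) :
  C 0%N = [set: V] -> C r = \bigcap_(H in A) H ->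
  (forall i, (i <= r)%N -> flats A (C i)) ->
  (forall i, (i < r)%N -> C i.+1 `<` C i) ->
  (forall i, (i < r)%N -> exists2 g : V -> K, lin_form g &
     forall w, C i w -> g w = 0 -> C i.+1 w) ->
  maximal_chain A r C.
Proof.
move=> C0 Cr flC decC formC; split=> // Z flZ cmp.
have ex0 : exists i, (i <= r)%N && `[< Z `<=` C i >].
  by exists 0%N; apply/asboolP; rewrite C0.
have bound i : (i <= r)%N && `[< Z `<=` C i >] -> (i <= r)%N by case/andP.
have [i /andP [ir /asboolP ZC] imax] := ex_maxnP ex0 bound.
exists i => //; apply/seteqP; split=> //.
have [ri|ltir] : i = r \/ (i < r)%N by lia.
  by rewrite ri Cr; case: flZ => _ [B BA ->] x Ax H BH; apply: Ax; apply: BA.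
have nZ : ~ Z `<=` C i.+1.
  by move=> sub; have := imax i.+1; rewrite ltir (asboolT sub) ltnn => /(_ isT).
have CZ : C i.+1 `<=` Z by case: (cmp i.+1 ltir).
have [g lg gC] := formC i ltir.
move/existsNP: nZ => [z /not_implyP [Zz nCz]] w Cw.
have gz : g z != 0 by apply/eqP => gz; apply: nCz; apply: gC => //; exact: ZC.
have Z0 := flat_contains0 flZ; have C0' := flat_contains0 (flC i ir).
have Cu : C i (w + (- (g w / g z)) *: (z - 0)).
  by apply: (flat_affine_closed (flC i ir)) => //; exact: ZC.
have Zu : Z (w + (- (g w / g z)) *: (z - 0)).
  apply: CZ; apply: gC Cu _.
  by rewrite lin_formB // lin_form_ker0 // subr0 mulNr divfK // subrr.
have := flat_affine_closed flZ (g w / g z) Zu Zz Z0.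
by rewrite scaleNr subrK.
Qed.

End Linear.
End LinearArrangements.

(** * Hyperplanes containing an intersection of two gain hyperplanes *)

Section Potentials.
Variables (K : fieldType) (n : nat).
Implicit Types (i j k l u v : 'I_n) (a b c : K) (f g : 'I_n -> K).

(** The equations [x_u - x_v = c] and [x_i - x_j = a] coincide up to sign. *)
Definition same_gain u v c i j a :=
  [/\ u = i, v = j & c = a] \/ [/\ u = j, v = i & c = - a].

(** Adding the indicator of a vertex set [W] to a point stays within every
    hyperplane whose edge does not leave [W]; this is how the edge [uv] is
    located. *)
Lemma indicator_constant (P : ('I_n -> K) -> Prop) u v c f (W : pred 'I_n) :
  (forall g, P g -> g u - g v = c) -> P f -> P (fun x => f x + (W x)%:R) -> W u = W v.
Proof.
move=> Pc Pf Pg; have := Pc _ Pg; rewrite -(Pc _ Pf) opprD addrACA -[RHS]addr0 => /addrI/eqP.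
by rewrite subr_eq0; case: (W u); case: (W v); rewrite // ?oner_eq0 // eq_sym oner_eq0.
Qed.

Lemma indicator_diff f (W : pred 'I_n) i j a :
  W i = W j -> f i - f j = a -> (f i + (W i)%:R) - (f j + (W j)%:R) = a.
Proof. by move=> -> <-; ring. Qed.

Lemma gain_single i j a u v c : i != j -> u != v ->
  (forall f, f i - f j = a -> f u - f v = c) -> same_gain u v c i j a.
Proof.
move=> ij uv H; pose f0 x := if x == i then a else 0.
have P0 : f0 i - f0 j = a by rewrite /f0 eqxx eq_sym (negPf ij) subr0.
have HW (W : pred _) : W i = W j -> W u = W v.
  by move=> Wij; apply: (indicator_constant H P0); apply: indicator_diff.
have [vi|vi] := eqVneq v i.
  have := HW (pred2 i j); rewrite /= !eqxx orbT => /(_ erefl).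
  rewrite vi eqxx -vi (negPf uv) /= => /eqP uj; right; split=> //.
  by rewrite -(H _ P0) uj vi -P0 opprB.
have [vj|vj] := eqVneq v j.
  have := HW (pred2 i j); rewrite /= !eqxx orbT => /(_ erefl).
  rewrite vj eqxx orbT -vj (negPf uv) orbF => /eqP ui; left; split=> //.
  by rewrite -(H _ P0) ui vj -P0.
have := HW (pred1 v); rewrite /= eq_sym (negPf vi) eq_sym (negPf vj) eqxx => /(_ erefl).
by rewrite (negPf uv).
Qed.

Lemma gain_at_infinity i j u v : u != v ->
  (forall g, g i = g j -> g u = g v) -> (u = i /\ v = j) \/ (u = j /\ v = i).
Proof.
move=> uv H.
have HW (W : pred 'I_n) : W i = W j -> W u = W v.
  move=> Wij; have : (W u)%:R = (W v)%:R :> K by apply: (H (fun x => (W x)%:R)); rewrite Wij.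
  by case: (W u); case: (W v) => // /eqP; rewrite ?oner_eq0 // eq_sym oner_eq0.
have [vi|vi] := eqVneq v i.
  have := HW (pred2 i j); rewrite /= !eqxx orbT => /(_ erefl).
  by rewrite vi eqxx -vi (negPf uv) /= => /eqP uj; right.
have [vj|vj] := eqVneq v j.
  have := HW (pred2 i j); rewrite /= !eqxx orbT => /(_ erefl).
  by rewrite vj eqxx orbT -vj (negPf uv) orbF => /eqP ui; left.
have := HW (pred1 v); rewrite /= eq_sym (negPf vi) eq_sym (negPf vj) eqxx => /(_ erefl).
by rewrite (negPf uv).
Qed.

Lemma gain_disjoint i j k l a b u v c : uniq [:: i; j; k; l] -> u != v ->
  (forall f, f i - f j = a -> f k - f l = b -> f u - f v = c) ->
  same_gain u v c i j a \/ same_gain u v c k l b.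
Proof.
rewrite /= !inE !negb_or -!andbA => /and5P [ij ik il jk /andP [jl /andP [kl _]]] uv H.
have H' f : f i - f j = a /\ f k - f l = b -> f u - f v = c by case; apply: H.
pose f0 x := if x == i then a else if x == k then b else 0.
have P1 : f0 i - f0 j = a.
  by rewrite /f0 eqxx eq_sym (negPf ij) (negPf jk) subr0.
have P2 : f0 k - f0 l = b.
  by rewrite /f0 eqxx eq_sym (negPf ik) eq_sym (negPf il) eq_sym (negPf kl) subr0.
have P0 := H _ P1 P2.
have HW (W : pred 'I_n) : W i = W j -> W k = W l -> W u = W v.
  by move=> Wij Wkl; apply: (indicator_constant H' (conj P1 P2)); split; apply: indicator_diff.
have W1 := HW (pred2 i j); have W2 := HW (pred2 k l); have W3 := HW (pred1 v).
move: W1 W2 W3; rewrite /= !eqxx !orbT (eq_sym k i) (eq_sym k j) (eq_sym l i) (eq_sym l j).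
rewrite (negPf ik) (negPf jk) (negPf il) (negPf jl) /= => /(_ erefl erefl) W1 /(_ erefl erefl) W2.
have [vi|vi] := eqVneq v i.
  move: W1; rewrite vi eqxx -vi (negPf uv) /= => /eqP uj _.
  by left; right; split=> //; rewrite -P0 uj vi -P1 opprB.
have [vj|vj] := eqVneq v j.
  move: W1; rewrite vj eqxx orbT -vj (negPf uv) orbF => /eqP ui _.
  by left; left; split=> //; rewrite -P0 ui vj -P1.
have [vk|vk] := eqVneq v k.
  move: W2; rewrite vk eqxx -vk (negPf uv) /= => /eqP ul _.
  by right; right; split=> //; rewrite -P0 ul vk -P2 opprB.
have [vl|vl] := eqVneq v l.
  move: W2; rewrite vl eqxx orbT -vl (negPf uv) orbF => /eqP uk _.
  by right; left; split=> //; rewrite -P0 uk vl -P2.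
by rewrite (negPf uv) => /(_ erefl erefl).
Qed.

Lemma gain_adjacent i j k a b u v c : uniq [:: i; j; k] -> u != v ->
  (forall f, f i - f j = a -> f j - f k = b -> f u - f v = c) ->
  [\/ same_gain u v c i j a, same_gain u v c j k b | same_gain u v c i k (a + b)].
Proof.
rewrite /= !inE !negb_or -!andbA => /and4P [ij ik jk _] uv H.
have H' f : f i - f j = a /\ f j - f k = b -> f u - f v = c by case; apply: H.
pose f0 x := if x == i then a + b else if x == j then b else 0.
have P1 : f0 i - f0 j = a by rewrite /f0 !eqxx eq_sym (negPf ij); ring.
have P2 : f0 j - f0 k = b.
  by rewrite /f0 eqxx eq_sym (negPf ij) eq_sym (negPf ik) eq_sym (negPf jk) subr0.
have P0 := H _ P1 P2.
have P3 : f0 i - f0 k = a + b by rewrite -P1 -P2; ring.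
have HW (W : pred 'I_n) : W i = W j -> W j = W k -> W u = W v.
  by move=> Wij Wjk; apply: (indicator_constant H' (conj P1 P2)); split; apply: indicator_diff.
have inV x y : x != y -> ((pred1 x) i = (pred1 x) j -> (pred1 x) j = (pred1 x) k -> (pred1 x) x = (pred1 x) y) ->
    [\/ x = i, x = j | x = k].
  move=> xy; rewrite /= !(eq_sym _ x) eqxx (negPf xy).
  have [->|_] := eqVneq x i; first by constructor 1.
  have [->|_] := eqVneq x j; first by constructor 2.
  have [->|_] := eqVneq x k; first by constructor 3.
  by move=> /(_ erefl erefl).
have vu : v != u by rewrite eq_sym.
have := inV u v uv (HW (pred1 u)).
have := inV v u vu (fun p q => esym (HW (pred1 v) p q)).
case=> eqv; case=> equ; move: uv; rewrite eqv equ ?eqxx // => _; move: P0; rewrite eqv equ => <-.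
- by constructor 1; right; split=> //; rewrite -P1 opprB.
- by constructor 3; right; split=> //; rewrite -P3 opprB.
- by constructor 1; left; split.
- by constructor 2; right; split=> //; rewrite -P2 opprB.
- by constructor 3; left; split.
- by constructor 2; left; split.
Qed.

End Potentials.

Section GainHyperplanes.
Variables (K : fieldType) (n : nat) (G : rel 'I_n) (S : 'I_n -> 'I_n -> {fset K}).
Hypotheses (G_simple : simple_graph G) (S_gain : gain_sets G S).
Implicit Types (i j k l u v : 'I_n) (a b c : K).

Lemma edge_neq i j : G i j -> i != j.
Proof. by move=> ij; apply: contraTneq ij => ->; case: G_simple => _ ->. Qed.

Lemma gainN i j a : i != j -> a \in S i j -> - a \in S j i.
Proof. by move=> /S_gain [-> _] aS; rewrite in_imfset. Qed.

Lemma gain_edge i j a : i != j -> a \in S i j -> G i j.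
Proof.
by move=> /S_gain [_ [+ _]] aS; apply; apply/fset0Pn; exists a.
Qed.

Lemma edge_gain i j : G i j -> exists a, a \in S i j.
Proof.
by move=> ij; have [_ [_ /(_ ij) /fset0Pn]] := S_gain (edge_neq ij).
Qed.

Lemma same_gain_in u v c i j a : u != v -> c \in S u v -> same_gain u v c i j a -> a \in S i j.
Proof.
move=> uv cS [] [<- <- ce]; first by rewrite -ce.
by rewrite -[a]opprK -ce; apply: gainN.
Qed.

Lemma gain_hyperplaneC i j a : gain_hyperplane j i (- a) = gain_hyperplane i j a.
Proof.
apply/seteqP; split=> x /=; last by move=> <-; rewrite opprB.
by move=> /(congr1 -%R); rewrite opprB opprK.
Qed.

Lemma cone_hyperplaneC i j a : cone_hyperplane j i (- a) = cone_hyperplane i j a.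
Proof.
apply/seteqP; split=> z; rewrite /cone_hyperplane /= mulNr.
  by move=> /(congr1 -%R); rewrite opprB opprK.
by move=> <-; rewrite opprB.
Qed.

Lemma same_gain_hyperplane u v c i j a : same_gain u v c i j a ->
  gain_hyperplane u v c = gain_hyperplane i j a.
Proof. by case=> [] [-> -> ->] //; rewrite gain_hyperplaneC. Qed.

Lemma same_cone_hyperplane u v c i j a : same_gain u v c i j a ->
  cone_hyperplane u v c = cone_hyperplane i j a.
Proof. by case=> [] [-> -> ->] //; rewrite cone_hyperplaneC. Qed.

Lemma gain_arrangement_mem i j a : i != j -> a \in S i j ->
  gain_arrangement S (gain_hyperplane i j a).
Proof.
move=> ij aS; case: (ltngtP i j) => [lt|lt|/ord_inj eq].
- by exists i, j, a.
- by exists j, i, (- a); rewrite gain_hyperplaneC; split=> //; apply: gainN.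
- by rewrite eq eqxx in ij.
Qed.

Lemma cone_arrangement_mem i j a : i != j -> a \in S i j ->
  cone_arrangement S (cone_hyperplane i j a).
Proof.
move=> ij aS; left; case: (ltngtP i j) => [lt|lt|/ord_inj eq].
- by exists i, j, a.
- by exists j, i, (- a); rewrite cone_hyperplaneC; split=> //; apply: gainN.
- by rewrite eq eqxx in ij.
Qed.

Lemma gain_arrangementE H : gain_arrangement S H ->
  exists i j a, [/\ i != j, a \in S i j & H = gain_hyperplane i j a].
Proof. by move=> [i [j [a [ij aS ->]]]]; exists i, j, a; split=> //; rewrite neq_ltn ij. Qed.

Lemma cone_arrangementE H : cone_arrangement S H -> H = hyperplane_at_infinity \/
  exists i j a, [/\ i != j, a \in S i j & H = cone_hyperplane i j a].
Proof.
by move=> [[i [j [a [ij aS ->]]]]|->]; [right|left] => //; exists i, j, a; split=> //; rewrite neq_ltn ij.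
Qed.

Definition cone_point (f : 'I_n -> K) (t : K) : 'rV[K]_(n + 1) :=
  row_mx (\row_i f i) (const_mx t).

Lemma cone_point_vertex f t i : lsubmx (cone_point f t) 0 i = f i.
Proof. by rewrite row_mxKl mxE. Qed.

Lemma cone_point_height f t : rsubmx (cone_point f t) 0 0 = t.
Proof. by rewrite row_mxKr mxE. Qed.

Lemma gain_hyperplane_sub i j a u v c : i != j -> u != v ->
  gain_hyperplane i j a `<=` gain_hyperplane u v c -> same_gain u v c i j a.
Proof.
move=> ij uv sub; apply: gain_single => // f fij.
by have := sub (\row_i f i); rewrite /gain_hyperplane /= !mxE; apply.
Qed.

Lemma cone_hyperplane_sub i j a u v c : i != j -> u != v ->
  cone_hyperplane i j a `<=` cone_hyperplane u v c -> same_gain u v c i j a.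
Proof.
move=> ij uv sub; apply: gain_single => // f fij.
have := sub (cone_point f 1).
by rewrite /cone_hyperplane /= !cone_point_vertex !cone_point_height !mulr1; apply.
Qed.

Lemma gain_disjoint_above i j k l a b H : uniq [:: i; j; k; l] ->
  gain_arrangement S H -> gain_hyperplane i j a `&` gain_hyperplane k l b `<=` H ->
  H = gain_hyperplane i j a \/ H = gain_hyperplane k l b.
Proof.
move=> un /gain_arrangementE [u [v [c [uv cS ->]]]] sub.
have [f f1 f2||] := gain_disjoint (a := a) (b := b) (c := c) un uv.
- by have := sub (\row_i f i); rewrite /gain_hyperplane /= !mxE; apply.
- by move=> /same_gain_hyperplane; left.
- by move=> /same_gain_hyperplane; right.
Qed.

Lemma gain_adjacent_above i j k a b H : uniq [:: i; j; k] ->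
  gain_arrangement S H -> gain_hyperplane i j a `&` gain_hyperplane j k b `<=` H ->
  [\/ H = gain_hyperplane i j a, H = gain_hyperplane j k b |
      a + b \in S i k /\ H = gain_hyperplane i k (a + b)].
Proof.
move=> un /gain_arrangementE [u [v [c [uv cS ->]]]] sub.
have [f f1 f2|||] := gain_adjacent (a := a) (b := b) (c := c) un uv.
- by have := sub (\row_i f i); rewrite /gain_hyperplane /= !mxE; apply.
- by move=> /same_gain_hyperplane; constructor 1.
- by move=> /same_gain_hyperplane; constructor 2.
- move=> sg; constructor 3; split; first exact: same_gain_in sg.
  exact: same_gain_hyperplane.
Qed.

Lemma cone_disjoint_above i j k l a b H : uniq [:: i; j; k; l] ->
  cone_arrangement S H -> cone_hyperplane i j a `&` cone_hyperplane k l b `<=` H ->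
  H = cone_hyperplane i j a \/ H = cone_hyperplane k l b.
Proof.
move=> un /cone_arrangementE [->|[u [v [c [uv cS ->]]]]] sub.
  have := un; rewrite /= !inE !negb_or -!andbA => /and5P [ij ik il jk /andP [jl /andP [kl _]]].
  pose f x := if x == i then a else if x == k then b else 0.
  have := sub (cone_point f 1); rewrite /hyperplane_at_infinity /cone_hyperplane /=.
  rewrite !cone_point_vertex !cone_point_height !mulr1 /f !eqxx.
  rewrite (eq_sym j) (negPf ij) (negPf jk) (eq_sym k) (negPf ik) (eq_sym l) (negPf il).
  by rewrite (eq_sym l) (negPf kl) !subr0 => /(_ (conj erefl erefl)) /eqP; rewrite oner_eq0.
have [f f1 f2||] := gain_disjoint (a := a) (b := b) (c := c) un uv.
- have := sub (cone_point f 1); rewrite /cone_hyperplane /=.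
  by rewrite !cone_point_vertex !cone_point_height !mulr1; apply.
- by move=> /same_cone_hyperplane; left.
- by move=> /same_cone_hyperplane; right.
Qed.

Lemma cone_adjacent_above i j k a b H : uniq [:: i; j; k] ->
  cone_arrangement S H -> cone_hyperplane i j a `&` cone_hyperplane j k b `<=` H ->
  [\/ H = cone_hyperplane i j a, H = cone_hyperplane j k b |
      a + b \in S i k /\ H = cone_hyperplane i k (a + b)].
Proof.
move=> un /cone_arrangementE [->|[u [v [c [uv cS ->]]]]] sub.
  have := un; rewrite /= !inE !negb_or -!andbA => /and4P [ij ik jk _].
  pose f x := if x == i then a + b else if x == j then b else 0.
  have := sub (cone_point f 1); rewrite /hyperplane_at_infinity /cone_hyperplane /=.
  rewrite !cone_point_vertex !cone_point_height !mulr1 /f !eqxx.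
  rewrite (eq_sym j) (negPf ij) (eq_sym k) (negPf ik) (eq_sym k) (negPf jk) subr0 addrK.
  by move=> /(_ (conj erefl erefl)) /eqP; rewrite oner_eq0.
have [f f1 f2|||] := gain_adjacent (a := a) (b := b) (c := c) un uv.
- have := sub (cone_point f 1); rewrite /cone_hyperplane /=.
  by rewrite !cone_point_vertex !cone_point_height !mulr1; apply.
- by move=> /same_cone_hyperplane; constructor 1.
- by move=> /same_cone_hyperplane; constructor 2.
- move=> sg; constructor 3; split; first exact: same_gain_in sg.
  exact: same_cone_hyperplane.
Qed.

Lemma cone_infinity_above i j a H :
  cone_arrangement S H -> hyperplane_at_infinity `&` cone_hyperplane i j a `<=` H ->
  H = hyperplane_at_infinity \/ exists2 b, b \in S i j & H = cone_hyperplane i j b.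
Proof.
move=> /cone_arrangementE [->|[u [v [c [uv cS ->]]]]] sub; [by left|right].
have sg : exists b, same_gain u v c i j b.
  have [g gij|[-> ->]|[-> ->]] := @gain_at_infinity K n i j u v uv.
  - apply/eqP; rewrite -subr_eq0; apply/eqP.
    have := sub (cone_point g 0); rewrite /hyperplane_at_infinity /cone_hyperplane /=.
    by rewrite !cone_point_vertex !cone_point_height !mulr0 gij subrr; apply.
  - by exists c; left.
  - by exists (- c); right; rewrite opprK.
have [b sgb] := sg; exists b; first exact: same_gain_in sgb.
exact: same_cone_hyperplane.
Qed.

Lemma cone_linear : linear_arrangement (cone_arrangement S).
Proof.
move=> H /cone_arrangementE [->|[i [j [a [_ _ ->]]]]].
  exists (fun z => rsubmx z 0 0) => // t x y.
  by rewrite linearP !mxE.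
exists (fun z : 'rV[K]_(n + 1) => lsubmx z 0 i - lsubmx z 0 j - a * rsubmx z 0 0).
  by move=> t x y; rewrite !linearP !mxE; ring.
by apply/seteqP; split=> z; rewrite /hyperplane_of /cone_hyperplane /=;
  [move=> ->; rewrite subrr|move=> /eqP; rewrite subr_eq0 => /eqP].
Qed.

End GainHyperplanes.

(** * From modular chains to admissible orderings *)

Section ChainToOrdering.
Variables (K : fieldType) (n : nat) (G : rel 'I_n) (S : 'I_n -> 'I_n -> {fset K}).
Hypotheses (G_simple : simple_graph G) (S_gain : gain_sets G S).
Implicit Types (i j k l u v c x y : 'I_n) (a b : K) (U : {set 'I_n}) (s : seq 'I_n).

Let G_sym i j : G i j -> G j i.
Proof. by case: G_simple => ->. Qed.

Definition admissible_rel c i j :=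
  forall a b, a \in S c i -> b \in S c j -> b - a \in S i j.

Lemma elimination_subsingleton (R : 'I_n -> 'I_n -> 'I_n -> Prop) s :
  (forall x y, x \in s -> y \in s -> x = y) -> elimination R s.
Proof.
elim: s => //= c s IH eq1; split; last first.
  by apply: IH => x y xs ys; apply: eq1; rewrite inE ?xs ?ys orbT.
move=> i j iS jS /eqP []; apply: eq1; by rewrite inE ?iS ?jS orbT.
Qed.

Section NearlyBalanced.
Variables (s : seq 'I_n) (p : 'I_n -> K).

Definition nontrivial i j := (i != j) && `[< exists2 a, a \in S i j & a != p i - p j >].

Lemma nontrivialC i j : nontrivial i j -> nontrivial j i.
Proof.
move=> /andP [ij /asboolP [a aS ap]]; rewrite /nontrivial eq_sym ij /=.
apply/asboolP; exists (- a); first exact: gainN S_gain _ _ _ ij aS.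
by apply: contraNneq ap => e; rewrite -[a]opprK e opprB.
Qed.

Hypothesis potential : forall i j, i \in s -> j \in s -> G i j -> p i - p j \in S i j.
Hypothesis disjoint_nontrivial : forall i j k l, i \in s -> j \in s -> k \in s -> l \in s ->
  uniq [:: i; j; k; l] -> nontrivial i j -> nontrivial k l -> False.
Hypothesis adjacent_nontrivial : forall i j k a b, i \in s -> j \in s -> k \in s ->
  uniq [:: i; j; k] -> a \in S i j -> b \in S j k -> a != p i - p j -> b != p j - p k ->
  a + b = p i - p k /\ a + b \in S i k.

(** Pairwise intersecting edges form a star or a triangle; either way all of
    them lie among a vertex [j] and its neighbours. *)
Lemma nontrivial_star : (exists i j, [/\ i \in s, j \in s & nontrivial i j]) ->
  exists2 j, j \in s & forall x y, x \in s -> y \in s -> nontrivial x y -> x != j -> y != j ->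
    nontrivial x j /\ nontrivial y j.
Proof.
move=> [i0 [j0 [i0s j0s nt0]]].
have neq x y : nontrivial x y -> x != y by case/andP.
have meet i j k l : i \in s -> j \in s -> k \in s -> l \in s ->
    nontrivial i j -> nontrivial k l -> k != j -> l != j -> k = i \/ l = i.
  move=> iS jS kS lS ij kl kj lj.
  have [ki|ki] := eqVneq k i; [by left|]; have [li|li] := eqVneq l i; [by right|].
  case: (disjoint_nontrivial iS jS kS lS _ ij kl).
  by rewrite /= !inE !negb_or (neq _ _ ij) (neq _ _ kl) !(eq_sym _ k) !(eq_sym _ l) ki li kj lj.
have [[j [i [k [jS iS kS [ij kj ik]]]]]|none] :=
    pselect (exists j i k, [/\ j \in s, i \in s, k \in s & [/\ nontrivial i j, nontrivial k j & i != k]]).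
  exists j => // x y xS yS xy xj yj.
  case: (meet i j x y) => // xi; case: (meet k j x y) => // xk.
  - by rewrite -xi -xk eqxx in ik.
  - by rewrite xi xk.
  - by rewrite xi xk.
  - by rewrite -xi -xk eqxx in ik.
exists j0 => // x y xS yS xy xj yj; case: none.
case: (meet i0 j0 x y) => // e0; exists i0.
  exists j0, y; split=> //; split=> //; [exact: nontrivialC|by apply: nontrivialC; rewrite -e0|by rewrite eq_sym].
by exists j0, x; split=> //; split=> //; [exact: nontrivialC|rewrite -e0|rewrite eq_sym].
Qed.

(** Once the gains that differ from those of a potential are confined to a star
    whose vertex set is a clique, a perfect elimination ordering that ends with
    this clique, centre last, is admissible.  The centre [j] has to come last:
    in the triangle formed by [j] and two leaves the gains of the leaf edge are
    too few to absorb differences of gains at [j]. *)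
Lemma nearly_balanced_elimination : uniq s -> elimination (simplicial_rel G) s ->
  exists2 t, perm_eq t s & elimination admissible_rel t.
Proof.
move=> us es.
have trivial_or c i : c != i -> forall a, a \in S c i -> nontrivial c i \/ a = p c - p i.
  move=> ci a aS; have [->|ap] := eqVneq a (p c - p i); [by right|left].
  by rewrite /nontrivial ci; apply/asboolP; exists a.
have edge i j a : i != j -> a \in S i j -> G i j by exact: gain_edge S_gain _ _ _.
have edge_nt i j : nontrivial i j -> G i j by case/andP => ij /asboolP [a aS _]; exact: edge aS.
have both_trivial c i j a b : i \in s -> j \in s -> G i j ->
    a = p c - p i -> b = p c - p j -> b - a \in S i j.
  move=> iS jS ij -> ->; have -> : p c - p j - (p c - p i) = p i - p j by ring.
  exact: potential.
have [/nontrivial_star [j jS star]|none] :=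
    pselect (exists i j, [/\ i \in s, j \in s & nontrivial i j]); last first.
  exists s => //; rewrite -[s]cats0; apply: (elimination_cat (R' := simplicial_rel G)); rewrite ?cats0 //.
  move=> c i k cS iS kS; rewrite /= !inE negb_or => /andP [/andP [ci ck] /andP [ik _]] sc a b aS bS.
  have ntF x y : x \in s -> y \in s -> nontrivial x y -> False.
    by move=> xs ys xy; apply: none; exists x, y.
  have [/ntF []//|aE] := trivial_or _ _ ci a aS.
  have [/ntF []//|bE] := trivial_or _ _ ck b bS.
  by apply: (both_trivial c) => //; apply: sc; [apply: edge aS|apply: edge bS].
pose leaves := [seq i <- s | nontrivial i j]; pose q := leaves ++ [:: j].
have inleaves x : (x \in leaves) = nontrivial x j && (x \in s) by rewrite mem_filter.
have inq x : (x \in q) = (x \in leaves) || (x == j) by rewrite mem_cat inE.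
have qs : {subset q <= s} by move=> x; rewrite inq inleaves => /orP [/andP []|/eqP ->].
have uq : uniq q.
  by rewrite cat_uniq filter_uniq //= orbF inleaves /nontrivial eqxx.
have nt_q x y : x \in s -> y \in s -> nontrivial x y -> x \in q.
  move=> xs ys xy; rewrite inq inleaves xs andbT; have [//|xj] := eqVneq x j; first by rewrite orbT.
  have [yj|yj] := eqVneq y j; first by rewrite -yj xy.
  by have [-> _] := star x y xs ys xy xj yj.
have gains x y z a b : nontrivial x y -> nontrivial y z -> x \in s -> y \in s -> z \in s -> x != z ->
    a \in S x y -> a != p x - p y -> b \in S y z -> b != p y - p z ->
    a + b = p x - p z /\ a + b \in S x z.
  move=> /andP [xy _] /andP [yz _] xs ys zs xz aS an bS bn.
  by apply: (@adjacent_nontrivial x y z) => //; rewrite /= !inE negb_or xy xz yz.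
have clq x y : x \in q -> y \in q -> x != y -> G x y.
  move=> /[dup] /qs xs; rewrite inq inleaves => xq /[dup] /qs ys; rewrite inq inleaves => yq xy.
  case/orP: xq => [/andP [ntx _]|/eqP xj].
    case/orP: yq => [/andP [nty _]|/eqP ->]; last exact: edge_nt.
    have [_ /asboolP [a aS an]] := andP ntx; have [_ /asboolP [b bS bn]] := andP (nontrivialC nty).
    by have [_ /edge ->] := gains x j y a b ntx (nontrivialC nty) xs jS ys xy aS an bS bn.
  case/orP: yq => [/andP [nty _]|/eqP yj]; first by rewrite xj; apply: G_sym; apply: edge_nt.
  by rewrite xj yj eqxx in xy.
have [t [pt et]] := clique_eliminated_last G_simple es us uq qs clq.
have ts x : x \in t ++ q -> x \in s by rewrite (perm_mem pt).
have ut : uniq (t ++ q) by rewrite (perm_uniq pt).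
exists (t ++ q) => //; apply: (elimination_cat et) => //; last first.
  move=> c i k ct iS kS un sc a b aS bS; have := un.
  rewrite /= !inE negb_or => /andP [/andP [ci ck] /andP [ik _]].
  have cs : c \in s by apply: ts; rewrite mem_cat ct.
  have cq : c \notin q.
    by move: ut; rewrite cat_uniq => /and3P [_ /hasPn h _]; apply/negP => /h; rewrite /= ct.
  have [/(nt_q _ _ cs (ts _ iS))|aE] := trivial_or _ _ ci a aS; first by rewrite (negPf cq).
  have [/(nt_q _ _ cs (ts _ kS))|bE] := trivial_or _ _ ck b bS; first by rewrite (negPf cq).
  by apply: (both_trivial c); rewrite ?ts //; apply: sc; [apply: edge aS|apply: edge bS].
apply: (elimination_cat (R' := fun _ _ _ => True)) => //; first by elim: (_ ++ _).
move=> c i k cl iq kq; rewrite /= !inE negb_or => /andP [/andP [ci ck] /andP [ik _]] _.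
have [iS kS] := (qs _ iq, qs _ kq); move: (cl); rewrite inleaves => /andP [ntc cS].
have nt_wit x y : nontrivial x y -> exists2 a, a \in S x y & a != p x - p y.
  by case/andP => _ /asboolP.
(* one gain at [c] trivial, the other one nontrivial *)
have mixed x y b : x \in q -> y \in q -> c != x -> c != y -> x != y -> b \in S c y -> b != p c - p y ->
    b - (p c - p x) \in S x y.
  move=> xq yq cx cy xy bS bn; have [xs ys] := (qs _ xq, qs _ yq).
  have ntcy : nontrivial c y by rewrite /nontrivial cy; apply/asboolP; exists b.
  move: xq yq; rewrite !inq !inleaves.
  have [xj _|xj] := eqVneq x j; have [yj|yj] := eqVneq y j.
  - by rewrite xj yj eqxx in xy.
  - rewrite orbF => /andP [nty _]; have [e eS en] := nt_wit _ _ nty.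
    have [|eE _] := gains c y j b e ntcy nty cS ys jS _ bS bn eS en; first by rewrite -xj.
    have -> : b - (p c - p x) = - e by rewrite xj -eE; ring.
    by rewrite xj; apply: gainN S_gain _ _ _ _ eS; rewrite -xj eq_sym.
  - rewrite orbF => /andP [ntx _] _; have [e eS en] := nt_wit _ _ ntx.
    have [e' e'S e'n] := nt_wit _ _ (nontrivialC ntx).
    have eS' : - e \in S j x by apply: gainN S_gain _ _ _ xj eS.
    have en' : - e != p j - p x by apply: contraNneq en => h; rewrite -[e]opprK h opprB.
    have bS' : b \in S c j by rewrite -yj.
    have bn' : b != p c - p j by rewrite -yj.
    have [eE _] := gains c j x b (- e) ntc (nontrivialC ntx) cS jS xs cx bS' bn' eS' en'.
    have -> : b - (p c - p x) = e by rewrite -eE; ring.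
    by rewrite yj.
  - rewrite !orbF => /andP [ntx _] /andP [nty _].
    case: (@disjoint_nontrivial c y x j) => //.
    rewrite /= !inE !negb_or cy cx (eq_sym y x) xy xj yj !andbT /=.
    by case/andP: ntc.
move=> a b aS bS.
have [ae|an] := eqVneq a (p c - p i); have [be|bn] := eqVneq b (p c - p k).
- by apply: (both_trivial c) => //; apply: clq.
- by rewrite ae; apply: mixed.
- have := mixed k i a kq iq ck ci _ aS an; rewrite eq_sym ik be => /(_ isT) h.
  by rewrite -opprB; apply: gainN S_gain _ _ _ _ h; rewrite eq_sym.
- have nic : nontrivial i c by apply: nontrivialC; rewrite /nontrivial ci; apply/asboolP; exists a.
  have nck : nontrivial c k by rewrite /nontrivial ck; apply/asboolP; exists b.
  have aS' : - a \in S i c by apply: gainN S_gain _ _ _ ci aS.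
  have an' : - a != p i - p c by apply: contraNneq an => h; rewrite -[a]opprK h opprB.
  by have [_] := gains i c k (- a) b nic nck iS cS kS ik aS' an' bS bn; rewrite addrC.
Qed.

End NearlyBalanced.

Section Chain.
Variables (r : nat) (C : nat -> set 'rV[K]_(n + 1)).
Hypothesis C0 : C 0%N = [set: _].
Hypothesis decreasing : forall k : nat, (k < r)%N -> C k.+1 `<=` C k.
Hypothesis exchange : forall (k : nat) H1 H2, (k < r)%N ->
  cone_arrangement S H1 -> cone_arrangement S H2 -> H1 <> H2 ->
  C k.+1 `<=` H1 -> C k.+1 `<=` H2 -> ~ C k `<=` H1 -> ~ C k `<=` H2 ->
  exists H3, [/\ cone_arrangement S H3, C k `<=` H3 & H1 `&` H2 `<=` H3].

Lemma cone_hyperplane_proper i j a : i != j -> ~ [set: _] `<=` cone_hyperplane i j a.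
Proof.
move=> ij /(_ (cone_point (fun x => (x == i)%:R) 0) I).
rewrite /cone_hyperplane /= !cone_point_vertex cone_point_height mulr0 eqxx.
by rewrite eq_sym (negPf ij) subr0 => /eqP; rewrite oner_eq0.
Qed.

Lemma infinity_proper : ~ [set: _] `<=` @hyperplane_at_infinity K n.
Proof.
move=> /(_ (cone_point (fun=> 0) 1) I).
by rewrite /hyperplane_at_infinity /= cone_point_height => /eqP; rewrite oner_eq0.
Qed.

(** One step down the chain, for the gains selected by [P].  The relation [eqv]
    records which differences of coordinates are those of the potential [q] on
    the flat [C k]; the crossing edges of [U] are those whose hyperplanes enter
    between [C k] and [C k.+1]. *)
Lemma chain_step (k : nat) U (P : 'I_n -> 'I_n -> K -> Prop) (q : 'I_n -> K) :
  let eqv i j := forall z, C k z -> lsubmx z 0 i - lsubmx z 0 j = (q i - q j) * rsubmx z 0 0 in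
  (k < r)%N -> block_on G U ->
  (forall i j, i \in U -> j \in U -> G i j -> exists a, P i j a) ->
  (forall i j a, P i j a -> i != j /\ a \in S i j) ->
  (forall i j a, i \in U -> j \in U -> P i j a -> C k.+1 `<=` cone_hyperplane i j a) ->
  (forall i j a, P i j a -> P j i (- a)) ->
  (forall i j a, C k `<=` cone_hyperplane i j a -> eqv i j) ->
  (forall i j a, i \in U -> j \in U -> P i j a -> eqv i j -> C k `<=` cone_hyperplane i j a) ->
  (forall i j, i \in U -> j \in U -> G i j -> eqv i j) \/
  exists c, [/\ c \in U,
    forall i j, i \in U :\ c -> j \in U :\ c -> G i j -> eqv i j &
    forall i j a b, i \in U -> j \in U -> i != j -> P c i a -> P c j b -> b - a \in S i j].
Proof.
move=> eqv kr bU exP PS Ck1 PN Ck Pk.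
have inA i j a : P i j a -> cone_arrangement S (cone_hyperplane i j a).
  by move=> /PS [ij aS]; exact: cone_arrangement_mem S_gain _ _ _ ij aS.
have edge i j a : P i j a -> G i j by move=> /PS [ij]; exact: gain_edge S_gain _ _ _ ij.
have exch i j k' l a b : i \in U -> j \in U -> k' \in U -> l \in U -> P i j a -> P k' l b ->
    i != k' -> i != l -> ~ eqv i j -> ~ eqv k' l ->
    exists H3, [/\ cone_arrangement S H3, C k `<=` H3,
      cone_hyperplane i j a `&` cone_hyperplane k' l b `<=` H3,
      H3 <> cone_hyperplane i j a & H3 <> cone_hyperplane k' l b].
  move=> iU jU kU lU Pa Pb ik il n1 n2.
  have nC1 : ~ C k `<=` cone_hyperplane i j a by move/Ck.
  have nC2 : ~ C k `<=` cone_hyperplane k' l b by move/Ck.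
  have neq : cone_hyperplane i j a <> cone_hyperplane k' l b.
    move=> e; have [ij _] := PS _ _ _ Pa; have [kl _] := PS _ _ _ Pb.
    have [] := @cone_hyperplane_sub K n k' l b i j a kl ij; first by rewrite e.
      by case=> e1; rewrite e1 eqxx in ik.
    by case=> e1; rewrite e1 eqxx in il.
  have [H3 [A3 CH3 sub]] := exchange kr (inA _ _ _ Pa) (inA _ _ _ Pb) neq
    (Ck1 _ _ _ iU jU Pa) (Ck1 _ _ _ kU lU Pb) nC1 nC2.
  by exists H3; split=> // e; rewrite e in CH3.
have adj i j l a b : i \in U -> j \in U -> l \in U -> uniq [:: i; j; l] -> P i j a -> P j l b ->
    ~ eqv i j -> ~ eqv j l ->
    a + b \in S i l /\ C k `<=` cone_hyperplane i l (a + b).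
  move=> iU jU lU un Pa Pb n1 n2; have := un.
  rewrite /= !inE negb_or => /andP [/andP [ij il] /andP [jl _]].
  have [H3 [A3 CH3 sub ne1 ne2]] := exch i j j l a b iU jU jU lU Pa Pb ij il n1 n2.
  by case: (cone_adjacent_above S_gain un A3 sub) => // -[abS e]; rewrite -e.
have [|||i j j' l iU jU kU lU un /(exP _ _ iU jU) [a Pa] /(exP _ _ kU lU) [b Pb]|i j l iU jU lU un /(exP _ _ iU jU) [a Pa] /(exP _ _ jU lU) [b Pb] n1 n2||[c [cU inner out]]] :=
  crossing_star (eqv := eqv) G_simple _ _ _ bU.
- by move=> x z _; rewrite !subrr mul0r.
- by move=> x y xy z /xy h; rewrite -opprB h -mulNr opprB.
- move=> y x w xy yw z Cz; rewrite -(subrKA (lsubmx z 0 y)) xy // yw //.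
  by ring.
- apply: contrapT => /not_orP [n1 n2]; have := un.
  rewrite /= !inE !negb_or -!andbA => /and5P [_ ik il _ _].
  have [H3 [A3 CH3 sub ne1 ne2]] := exch i j j' l a b iU jU kU lU Pa Pb ik il n1 n2.
  by case: (cone_disjoint_above un A3 sub).
- by have [_] := adj i j l a b iU jU lU un Pa Pb n1 n2 => /Ck.
- by move=> h; left.
right; exists c; split=> // i j a b iU jU ij Pa Pb.
have [ci _] := PS _ _ _ Pa; have [cj _] := PS _ _ _ Pb.
have n1 : ~ eqv i c.
  move=> h; apply: (out i iU (edge _ _ _ Pa)) => z /h e.
  by rewrite -opprB e -mulNr opprB.
have n2 := out j jU (edge _ _ _ Pb).
have un : uniq [:: i; c; j] by rewrite /= !inE negb_or (eq_sym i c) ci ij cj.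
by have [+ _] := adj i c j (- a) b iU cU jU un (PN _ _ _ Pa) Pb n1 n2; rewrite addrC.
Qed.

Lemma edgeless_elimination U (R : 'I_n -> 'I_n -> 'I_n -> Prop) : block_on G U ->
  (forall i j, i \in U -> j \in U -> ~ G i j) ->
  exists s, [/\ uniq s, s =i U & elimination R s].
Proof.
move=> [cU _] noG; exists (enum U); split=> [|x|]; rewrite ?enum_uniq ?mem_enum //.
apply: elimination_subsingleton => x y; rewrite !mem_enum => xU yU.
apply/eqP/negP => /negP xy.
by have [z zU /(noG _ _ xU zU)] := connected_on_edge cU xU yU xy.
Qed.

(** The hyperplanes whose gains come from the potential [p] form a graphic
    arrangement, for which [chain_step] makes the vertex common to the crossing
    edges simplicial. *)
Lemma balanced_elimination (p : 'I_n -> K) (k : nat) U : (k <= r)%N -> block_on G U ->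
  (exists z, [/\ C k z, rsubmx z 0 0 != 0 & forall i, lsubmx z 0 i = p i * rsubmx z 0 0]) ->
  (forall i j, i \in U -> j \in U -> G i j ->
     p i - p j \in S i j /\ C k `<=` cone_hyperplane i j (p i - p j)) ->
  exists s, [/\ uniq s, s =i U & elimination (simplicial_rel G) s].
Proof.
elim: k U => [|k IH] U kr bU exz hU.
  apply: edgeless_elimination => // i j iU jU ij; have [_] := hU i j iU jU ij.
  by rewrite C0; apply: cone_hyperplane_proper; apply: edge_neq ij.
have [z0 [Cz0 y0 z0E]] := exz; have Ckz0 : C k z0 by exact: decreasing Cz0.
have exz' : exists z, [/\ C k z, rsubmx z 0 0 != 0 & forall i, lsubmx z 0 i = p i * rsubmx z 0 0].
  by exists z0.
pose P i j a := [/\ i \in U, j \in U, G i j & a = p i - p j].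
have PS i j a : P i j a -> i != j /\ a \in S i j.
  by move=> [iU jU ij ->]; split; [exact: edge_neq ij|case: (hU i j iU jU ij)].
have atz0 i j a : cone_hyperplane i j a z0 -> a = p i - p j.
  rewrite /cone_hyperplane /= !z0E -mulrBl => /eqP; rewrite eq_sym => /eqP.
  exact: mulIf.
have [||||||all|[c [cU inner simp]]] := @chain_step k U P p kr bU.
- by move=> i j iU jU ij; exists (p i - p j).
- exact: PS.
- by move=> i j a iU jU [_ _ ij ->]; case: (hU i j iU jU ij).
- by move=> i j a [iU jU ij ->]; split=> //; [exact: G_sym|rewrite opprB].
- by move=> i j a sub z /sub; rewrite -(atz0 i j a (sub _ Ckz0)).
- by move=> i j a iU jU [_ _ _ ->] h z /h.
- apply: IH; [exact: ltnW|exact: bU|exact: exz'|].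
  by move=> i j iU jU ij; split; [case: (hU i j iU jU ij)|move=> z /(all i j iU jU ij)].
have sc : simplicial G c U.
  move=> i j iU jU ij ci cj; apply: (gain_edge S_gain ij).
  by apply: (simp i j (p c - p i) (p c - p j)).
have [|s [us sU es]] := IH (U :\ c) (ltnW kr) (block_on_remove G_simple bU cU sc) exz'.
  move=> i j iU jU ij; split; last by move=> z /(inner i j iU jU ij).
  by move: iU jU; rewrite !inE => /andP [_ iU] /andP [_ jU]; case: (hU i j iU jU ij).
exists (c :: s); split.
- by rewrite /= us sU !inE eqxx.
- move=> x; rewrite inE sU !inE; by have [->|] := eqVneq x c; rewrite ?cU.
- split=> // i j; rewrite !sU !inE => /andP [_ iU] /andP [_ jU]; exact: sc.
Qed.

(** Induction down the chain, with [U] the vertices not yet removed.  As soon as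
    [C k] is not contained in the hyperplane at infinity, a point of [C k] of
    nonzero height provides a potential, and every edge still has a gain
    agreeing with it: the exchange property applied to the hyperplane at
    infinity and any other hyperplane of the edge yields one. *)
Lemma admissible_elimination (k : nat) U : (k <= r)%N -> block_on G U ->
  C k `<=` hyperplane_at_infinity ->
  (forall i j a, i \in U -> j \in U -> i != j -> a \in S i j -> C k `<=` cone_hyperplane i j a) ->
  exists s, [/\ uniq s, s =i U & elimination admissible_rel s].
Proof.
elim: k U => [|k IH] U kr bU Cinf hU; first by case: infinity_proper; rewrite -C0.
have [Ckinf|Ckinf] := pselect (C k `<=` hyperplane_at_infinity).
  pose P i j a := i != j /\ a \in S i j.
  have eq0 i j : (forall z, C k z -> lsubmx z 0 i - lsubmx z 0 j = (0 - 0) * rsubmx z 0 0) ->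
      forall a, C k `<=` cone_hyperplane i j a.
    move=> h a z Cz; rewrite /cone_hyperplane /= h // subrr mul0r.
    by rewrite (_ : rsubmx z 0 0 = 0) ?mulr0 //; exact: Ckinf.
  have [||||||all|[c [cU inner adm]]] := @chain_step k U P (fun=> 0) kr bU.
  - by move=> i j iU jU ij; have [a aS] := edge_gain G_simple S_gain ij; exists a; split=> //; exact: edge_neq ij.
  - by [].
  - by move=> i j a iU jU [ij aS]; apply: hU.
  - by move=> i j a [ij aS]; split; [rewrite eq_sym|exact: gainN S_gain _ _ _ ij aS].
  - move=> i j a sub z Cz; rewrite subrr mul0r; have := sub z Cz.
    by rewrite /cone_hyperplane /= => ->; rewrite (_ : rsubmx z 0 0 = 0) ?mulr0 //; exact: Ckinf.
  - by move=> i j a iU jU _ /eq0.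
  - apply: IH => //; first exact: ltnW.
    by move=> i j a iU jU ij aS; apply/eq0/all/(gain_edge S_gain ij aS).
  have sc : simplicial G c U.
    move=> i j iU jU ij ci cj; have [a aS] := edge_gain G_simple S_gain ci.
    have [b bS] := edge_gain G_simple S_gain cj; apply: (gain_edge S_gain ij).
    by apply: (adm i j a b) => //; split=> //; apply: (edge_neq G_simple).
  have [//||s [us sU es]] := IH (U :\ c) (ltnW kr) (block_on_remove G_simple bU cU sc).
    by move=> i j a iU jU ij aS; apply/eq0/inner/(gain_edge S_gain ij aS).
  exists (c :: s); split.
  - by rewrite /= us sU !inE eqxx.
  - move=> x; rewrite inE sU !inE; by have [->|] := eqVneq x c; rewrite ?cU.
  - split=> // i j; rewrite !sU !inE => /andP [ic iU] /andP [jc jU] ij a b aS bS.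
    by apply: (adm i j a b) => //; split=> //; rewrite eq_sym.
have [z0 [Cz0 y0]] : exists z, C k z /\ rsubmx z 0 0 != 0.
  by move/existsNP: Ckinf => [z /not_implyP [Cz /eqP yz]]; exists z.
pose p i := lsubmx z0 0 i / rsubmx z0 0 0.
have z0E i : lsubmx z0 0 i = p i * rsubmx z0 0 0 by rewrite /p divfK.
have atz0 i j a : C k `<=` cone_hyperplane i j a -> a = p i - p j.
  move=> /(_ z0 Cz0); rewrite /cone_hyperplane /= !z0E -mulrBl => /eqP; rewrite eq_sym => /eqP.
  exact: mulIf.
have inA i j a : i != j -> a \in S i j -> cone_arrangement S (cone_hyperplane i j a).
  exact: cone_arrangement_mem S_gain _ _ _.
have pot i j : i \in U -> j \in U -> G i j ->
    p i - p j \in S i j /\ C k `<=` cone_hyperplane i j (p i - p j).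
  move=> iU jU ij; have ne := edge_neq G_simple ij.
  have [a aS] := edge_gain G_simple S_gain ij.
  have [sub|nsub] := pselect (C k `<=` cone_hyperplane i j a).
    by have := sub; rewrite (atz0 _ _ _ sub) => sub'; rewrite -{1}(atz0 _ _ _ sub).
  have neqH : hyperplane_at_infinity <> cone_hyperplane i j a.
    move=> e; have : hyperplane_at_infinity (cone_point (fun x => if x == i then a else 0) 1).
      rewrite e /cone_hyperplane /= !cone_point_vertex cone_point_height mulr1 eqxx.
      by rewrite eq_sym (negPf ne) subr0.
    by rewrite /hyperplane_at_infinity /= cone_point_height => /eqP; rewrite oner_eq0.
  have Ainf : cone_arrangement S hyperplane_at_infinity by right.
  have [H3 [A3 CH3 sub]] := exchange kr Ainf (inA _ _ _ ne aS) neqH Cinf (hU _ _ _ iU jU ne aS) Ckinf nsub.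
  have [e|[b bS e]] := cone_infinity_above S_gain A3 sub; first by rewrite e in CH3.
  rewrite e in CH3; by rewrite -(atz0 _ _ _ CH3).
have exz : exists z, [/\ C k z, rsubmx z 0 0 != 0 & forall i, lsubmx z 0 i = p i * rsubmx z 0 0].
  by exists z0.
have [s [us sU es]] := balanced_elimination (ltnW kr) bU exz pot.
have exch i j l m a b : i \in U -> j \in U -> l \in U -> m \in U -> i != j -> l != m ->
    a \in S i j -> b \in S l m -> a != p i - p j -> b != p l - p m -> i != l -> i != m ->
    exists H3, [/\ cone_arrangement S H3, C k `<=` H3,
      cone_hyperplane i j a `&` cone_hyperplane l m b `<=` H3,
      H3 <> cone_hyperplane i j a & H3 <> cone_hyperplane l m b].
  move=> iU jU lU mU ij lm aS bS an bn il im.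
  have n1 : ~ C k `<=` cone_hyperplane i j a by move=> /atz0 e; rewrite e eqxx in an.
  have n2 : ~ C k `<=` cone_hyperplane l m b by move=> /atz0 e; rewrite e eqxx in bn.
  have neqH : cone_hyperplane i j a <> cone_hyperplane l m b.
    move=> e; have [] := @cone_hyperplane_sub K n l m b i j a lm ij; first by rewrite e.
      by case=> e1; rewrite e1 eqxx in il.
    by case=> e1; rewrite e1 eqxx in im.
  have [H3 [A3 CH3 sub]] := exchange kr (inA _ _ _ ij aS) (inA _ _ _ lm bS) neqH
    (hU _ _ _ iU jU ij aS) (hU _ _ _ lU mU lm bS) n1 n2.
  by exists H3; split=> // e; rewrite e in CH3.
have [|||||t pt et] := @nearly_balanced_elimination s p.
- by move=> i j; rewrite !sU => iU jU ij; case: (pot i j iU jU ij).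
- move=> i j l m; rewrite !sU => iU jU lU mU un /andP [ij /asboolP [a aS an]] /andP [lm /asboolP [b bS bn]].
  have := un; rewrite /= !inE !negb_or -!andbA => /and5P [_ il im _ _].
  have [H3 [A3 CH3 sub ne1 ne2]] := exch i j l m a b iU jU lU mU ij lm aS bS an bn il im.
  by case: (cone_disjoint_above un A3 sub).
- move=> i j l a b; rewrite !sU => iU jU lU un aS bS an bn.
  have := un; rewrite /= !inE !negb_or -!andbA => /and4P [ij il jl _].
  have [H3 [A3 CH3 sub ne1 ne2]] := exch i j j l a b iU jU jU lU ij jl aS bS an bn ij il.
  case: (cone_adjacent_above S_gain un A3 sub) => // -[abS e].
  by rewrite e in CH3; split=> //; exact: atz0.
- exact: us.
- exact: es.
by exists t; split=> //; [rewrite (perm_uniq pt)|move=> x; rewrite (perm_mem pt)].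
Qed.

End Chain.
End ChainToOrdering.

(** * From admissible orderings to modular chains *)

Section OrderingToChain.
Variables (K : fieldType) (n : nat) (G : rel 'I_n) (S : 'I_n -> 'I_n -> {fset K}).
Hypotheses (G_simple : simple_graph G) (S_gain : gain_sets G S) (G_block : is_block G).
Implicit Types (i j u c x : 'I_n) (a b : K) (m k : nat).

Variable pos : 'I_n -> nat.
Hypothesis pos_lt : forall x, (pos x < n)%N.
Hypothesis pos_inj : injective pos.
Hypothesis pos_onto : forall m, (m < n)%N -> exists x, pos x = m.
Hypothesis pos_admissible : forall c i j, (pos c < pos i)%N -> (pos c < pos j)%N ->
  i != j -> admissible_rel S c i j.

Lemma later_clique c i j : (pos c < pos i)%N -> (pos c < pos j)%N -> i != j ->
  G c i -> G c j -> G i j.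
Proof.
move=> ci cj ij ec ed; have [a aS] := edge_gain G_simple S_gain ec.
have [b bS] := edge_gain G_simple S_gain ed.
by apply: (gain_edge S_gain ij (pos_admissible ci cj ij aS bS)).
Qed.

Lemma connected_on_tail m : (m <= n)%N -> connected_on G [set x | (m <= pos x)%N]%SET.
Proof.
elim: m => [|m IH] mn.
  have [conn _] := block_onT G_block.
  by move=> x y _ _; rewrite (_ : finset _ = finset.setTfor _); [apply: conn; rewrite inE|apply/setP => z; rewrite !inE].
have [c pc] := pos_onto mn.
have -> : [set x | (m < pos x)%N]%SET = ([set x | (m <= pos x)%N] :\ c)%SET.
  apply/setP => x; rewrite !inE; have [->|xc] := eqVneq x c; first by rewrite pc ltnn.
  by rewrite ltn_neqAle; case: eqP => // e; rewrite -pc in e; rewrite (pos_inj e) eqxx in xc.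
apply: connected_on_remove (IH (ltnW mn)) _ => // i j; rewrite !inE => mi mj ij ci cj.
apply: (@later_clique c) => //; rewrite pc ltn_neqAle ?mi ?mj andbT -pc.
  by apply: contraTneq (edge_neq G_simple ci) => /pos_inj ->; rewrite eqxx.
by apply: contraTneq (edge_neq G_simple cj) => /pos_inj ->; rewrite eqxx.
Qed.

Lemma later_neighbor c : (pos c < n.-1)%N -> exists2 u, (pos c < pos u)%N & G c u.
Proof.
move=> cn; have [x px] : exists x, pos x = n.-1 by apply: pos_onto; lia.
have cx : c != x by apply: contraTneq cn => ->; rewrite px ltnn.
have [|||z] := connected_on_edge (x := c) (y := x) (connected_on_tail (ltnW (pos_lt c))).
- by rewrite inE.
- by rewrite inE px ltnW.
- exact: cx.
rewrite inE leq_eqVlt => /orP [/eqP /pos_inj ->|cz ecz]; last by exists z.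
by case: G_simple => _ ->.
Qed.

(** For [m < n] this is the flat of points at infinity whose last [n - m]
    coordinates agree; asking for equality along edges only makes it an
    intersection of hyperplanes by construction. *)
Definition tail_flat m : set 'rV[K]_(n + 1) :=
  [set z | rsubmx z 0 0 = 0 /\ forall i j, (m <= pos i)%N -> (m <= pos j)%N -> G i j ->
     lsubmx z 0 i = lsubmx z 0 j].

Let A := cone_arrangement S.
Let linA : linear_arrangement A := @cone_linear K n S.

Lemma tail_flat_infinity m : tail_flat m `<=` hyperplane_at_infinity.
Proof. by move=> z []. Qed.

Lemma tail_flat_gain m i j a : (m <= pos i)%N -> (m <= pos j)%N -> G i j ->
  tail_flat m `<=` cone_hyperplane i j a.
Proof.
by move=> mi mj ij z [y0 zz]; rewrite /cone_hyperplane /= (zz i j) // y0 subrr mulr0.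
Qed.

Lemma tail_flatE m : tail_flat m = \bigcap_(H in [set H | A H /\ tail_flat m `<=` H]) H.
Proof.
apply/seteqP; split=> [z Fz H [_ sub]|z capz]; first exact: sub.
have y0 : rsubmx z 0 0 = 0.
  by apply: (capz hyperplane_at_infinity); split; [right|exact: tail_flat_infinity].
split=> // i j mi mj ij; have [a aS] := edge_gain G_simple S_gain ij.
have : cone_hyperplane i j a z.
  apply: capz; split; last exact: tail_flat_gain.
  exact: cone_arrangement_mem S_gain _ _ _ (edge_neq G_simple ij) aS.
by rewrite /cone_hyperplane /= y0 mulr0 => /eqP; rewrite subr_eq0 => /eqP.
Qed.

Lemma tail_flat_flat m : flats A (tail_flat m).
Proof.
split; first by exists 0; rewrite /tail_flat /= !mxE; split=> // i j; rewrite !mxE.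
by exists [set H | A H /\ tail_flat m `<=` H]; [move=> H []|exact: tail_flatE].
Qed.

Lemma tail_flat0 : tail_flat 0 = \bigcap_(H in A) H.
Proof.
rewrite tail_flatE; congr bigcap; apply/seteqP; split=> H; first by case.
move=> AH; split=> //; case: (cone_arrangementE AH) => [->|[i [j [a [ij aS ->]]]]].
  exact: tail_flat_infinity.
by apply: tail_flat_gain => //; exact: gain_edge S_gain _ _ _ ij aS.
Qed.

(** A point satisfying those equations of a flat [Y] that only involve the
    last vertices extends to a point of [Y]: the coordinates of the earlier
    vertices are filled in one at a time, and admissibility says that the
    conditions put on a new coordinate agree. *)
Lemma tail_extension (Y : set 'rV[K]_(n + 1)) m (z : 'rV[K]_(n + 1)) : flats A Y ->
  (m <= n)%N ->
  (Y `<=` hyperplane_at_infinity -> rsubmx z 0 0 = 0) ->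
  (forall i j a, (m <= pos i)%N -> (m <= pos j)%N -> i != j -> a \in S i j ->
     Y `<=` cone_hyperplane i j a -> cone_hyperplane i j a z) ->
  exists y, [/\ Y y, rsubmx y 0 0 = rsubmx z 0 0 &
    forall i, (m <= pos i)%N -> lsubmx y 0 i = lsubmx z 0 i].
Proof.
move=> flY; elim: m z => [|m IH] z mn zinf zY.
  exists z; split=> //; have [_ [B BA YE]] := flY; rewrite YE => H BH.
  have YH : Y `<=` H by rewrite YE; exact: bigcap_inf.
  case: (cone_arrangementE (BA H BH)) YH => [->|[i [j [a [ij aS ->]]]]]; [exact: zinf|exact: zY].
have [c pc] := pos_onto mn.
have [t ht] : exists t, forall j b, (m < pos j)%N -> b \in S c j ->
    Y `<=` cone_hyperplane c j b -> t - lsubmx z 0 j = b * rsubmx z 0 0.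
  have [[i [a [mi aS YH]]]|none] := pselect (exists i a,
      [/\ (m < pos i)%N, a \in S c i & Y `<=` cone_hyperplane c i a]); last first.
    by exists 0 => j b mj bS YH; case: none; exists j, b.
  exists (lsubmx z 0 i + a * rsubmx z 0 0) => j b mj bS YH'.
  have [ij|ij] := eqVneq i j.
    rewrite -ij addrAC subrr add0r; have [->//|ab] := eqVneq a b.
    rewrite zinf ?mulr0 // => y Yy; move: (YH y Yy) (YH' y Yy); rewrite /cone_hyperplane /= -ij => ->.
    by move/eqP; rewrite -subr_eq0 -mulrBl mulf_eq0 subr_eq0 (negPf ab) => /eqP.
  have ciS : b - a \in S i j by apply: (pos_admissible _ _ ij) aS bS; rewrite pc.
  have : cone_hyperplane i j (b - a) z.
    apply: zY => // y Yy; move: (YH y Yy) (YH' y Yy); rewrite /cone_hyperplane /= => e1 e2.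
    by rewrite mulrBl -e1 -e2; ring.
  rewrite /cone_hyperplane /= mulrBl => e.
  by rewrite addrAC e; ring.
pose f i := if i == c then t else lsubmx z 0 i.
have fc : f c = t by rewrite /f eqxx.
have fne i : i != c -> f i = lsubmx z 0 i by rewrite /f => /negPf ->.
have [|||y [Yy yh yv]] := IH (cone_point f (rsubmx z 0 0)).
- exact: ltnW.
- by rewrite cone_point_height.
- have case_c j b : (m <= pos j)%N -> c != j -> b \in S c j -> Y `<=` cone_hyperplane c j b ->
      f c - f j = b * rsubmx z 0 0.
    move=> mj cj bS YH; rewrite fc fne 1?eq_sym //; apply: ht => //.
    by rewrite ltn_neqAle mj andbT -pc; apply: contraNneq cj => /pos_inj ->.
  move=> i j a mi mj ij aS YH; rewrite /cone_hyperplane /= !cone_point_vertex cone_point_height.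
  have [ic|ic] := eqVneq i c; first by rewrite ic in ij aS YH *; exact: case_c.
  have [jc|jc] := eqVneq j c.
    rewrite jc in ij aS YH *; rewrite -opprB (case_c i (- a)) ?mulNr ?opprK //.
    - by rewrite eq_sym.
    - exact: gainN S_gain _ _ _ ij aS.
    - by rewrite cone_hyperplaneC.
  rewrite !fne //; apply: zY => //.
    by rewrite ltn_neqAle mi andbT -pc; apply: contraNneq ic => /pos_inj ->.
  by rewrite ltn_neqAle mj andbT -pc; apply: contraNneq jc => /pos_inj ->.
exists y; split=> //; first by rewrite yh cone_point_height.
move=> i mi; rewrite yv ?(ltnW mi) // cone_point_vertex fne //.
by apply: contraTneq mi => ->; rewrite pc ltnn.
Qed.

Lemma tail_flat_modular m : (m <= n)%N -> modular A (tail_flat m).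
Proof.
move=> mn; apply: (modular_of_sum linA (tail_flat_flat m)) => Y flY.
exists (\bigcap_(H in [set H | [/\ A H, tail_flat m `<=` H & Y `<=` H]]) H); split.
- split; last by exists [set H | [/\ A H, tail_flat m `<=` H & Y `<=` H]] => // H [].
  by exists 0 => H [AH _ _]; exact: hyperplane_contains0 linA _ AH.
- by move=> z Fz H [_ sub _]; exact: sub.
- by move=> z Yz H [_ _ sub]; exact: sub.
move=> z Mz; have [|i j a mi mj ij aS YH|y [Yy yh yv]] := tail_extension (z := z) flY mn.
- by move=> Yinf; apply: (Mz hyperplane_at_infinity); split=> //; [right|exact: tail_flat_infinity].
- apply: Mz; split=> //; first exact: cone_arrangement_mem S_gain _ _ _ ij aS.
  by apply: tail_flat_gain => //; exact: gain_edge S_gain _ _ _ ij aS.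
exists (z - y), y; split=> //; last by rewrite subrK.
have vB i : lsubmx (z - y) 0 i = lsubmx z 0 i - lsubmx y 0 i by rewrite linearB !mxE.
have hB : rsubmx (z - y) 0 0 = rsubmx z 0 0 - rsubmx y 0 0 by rewrite linearB !mxE.
by split; [rewrite hB yh subrr|move=> i j mi mj _; rewrite !vB !yv // !subrr].
Qed.

Definition tail_chain k := if k is k'.+1 then tail_flat (n.-1 - k') else [set: 'rV[K]_(n + 1)].

Lemma tail_flat_last : tail_flat n.-1 = hyperplane_at_infinity.
Proof.
apply/seteqP; split=> [z []|z zinf] //; split=> // i j mi mj ij.
have pij : pos i = pos j by have := pos_lt i; have := pos_lt j; lia.
by rewrite (pos_inj pij).
Qed.

Lemma tail_chain_maximal_modular :
  maximal_modular_chain A n.-1.+1 tail_chain /\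
  chain_through n.-1.+1 tail_chain hyperplane_at_infinity.
Proof.
have flC (i : nat) : flats A (tail_chain i).
  by case: i => [|i]; [exact: flatT|exact: tail_flat_flat].
have step k : (k < n.-1)%N -> exists c u, [/\ pos c = n.-1 - k.+1,
    (pos c < pos u)%N & G c u]%N.
  move=> kn; have [c pc] : exists c, pos c = (n.-1 - k.+1)%N by apply: pos_onto; lia.
  have [u cu ecu] : exists2 u, (pos c < pos u)%N & G c u by apply: later_neighbor; lia.
  by exists c, u.
split; last by split=> //; rewrite /tail_chain subn0 tail_flat_last.
split; last first.
  case=> [|i] ir; last by apply: tail_flat_modular; lia.
  apply: (modular_of_sum linA (flC 0)) => Y flY; exists [set: _]; split=> //; first exact: flatT.
  by move=> z _; exists z, 0; split; rewrite ?addr0 //; exact: flat_contains0 linA _ flY.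
apply: (maximal_chain_of_forms linA) => //.
- by rewrite /tail_chain subnn tail_flat0.
- case=> [_|k kn] /=.
    by rewrite subn0 tail_flat_last; split=> // /infinity_proper.
  have [c [u [pc cu ecu]]] := step k kn.
  split; last first.
    move=> sub; have : tail_flat (n.-1 - k) (cone_point (fun x => (x == c)%:R) 0).
      split; first by rewrite cone_point_height.
      move=> i j mi mj _; rewrite !cone_point_vertex.
      have [ic|_] := eqVneq i c; first by move: mi; rewrite ic pc; lia.
      by have [jc|_ //] := eqVneq j c; first by move: mj; rewrite jc pc; lia.
    move=> /sub [_ /(_ c u)]; rewrite !cone_point_vertex eqxx -pc leqnn (ltnW cu) => /(_ isT isT ecu).
    by rewrite eq_sym (negPf (edge_neq G_simple ecu)) => /eqP; rewrite oner_eq0.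
  by move=> z [y0 zz]; split=> // i j mi mj; apply: zz; lia.
case=> [_|k kn] /=.
  rewrite subn0 tail_flat_last; exists (fun z : 'rV[K]_(n + 1) => rsubmx z 0 0) => // t x y.
  by rewrite linearP !mxE.
have [c [u [pc cu ecu]]] := step k kn.
exists (fun z : 'rV[K]_(n + 1) => lsubmx z 0 c - lsubmx z 0 u).
  by move=> t x y; rewrite !linearP !mxE; ring.
move=> z [y0 zz] /eqP; rewrite subr_eq0 => /eqP zcu.
have zc j : (n.-1 - k.+1 <= pos j)%N -> G c j -> lsubmx z 0 c = lsubmx z 0 j.
  move=> mj ecj; have [<-//|uj] := eqVneq u j.
  have cj : (pos c < pos j)%N.
    by rewrite ltn_neqAle pc mj andbT -pc; apply: contraTneq (edge_neq G_simple ecj) => /pos_inj ->; rewrite eqxx.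
  by rewrite zcu; apply: zz; [lia|lia|exact: later_clique cu cj uj ecu ecj].
split=> // i j mi mj eij.
have [ic|ic] := eqVneq i c; first by rewrite ic in eij *; exact: zc.
have [jc|jc] := eqVneq j c.
  by rewrite jc in eij *; rewrite -zc //; case: G_simple => ->.
have neqp x : x != c -> pos x != pos c by apply: contraNneq => /pos_inj ->.
by apply: zz => //; [have := neqp i ic|have := neqp j jc]; rewrite pc; lia.
Qed.

End OrderingToChain.

(** * From admissible orderings to nice partitions *)

Lemma card_setD1_II (T : Type) (X : set T) (x : T) p :
  (X #= `I_p.+1)%card -> X x -> (X `\ x #= `I_p)%card.
Proof.
elim: p X => [|p IH] X cX Xx; have [y Xy cy] := eq_cardSP _ _ cX.
  have XyE : X `\ y = set0 by apply/eqP; rewrite -(card_eq0 (U := nat)) -II0.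
  have [xy|xy] := pselect (x = y); first by rewrite xy.
  by have : (X `\ y) x by []; rewrite XyE.
have [->//|xy] := pselect (x = y).
apply/eq_cardSP; exists y; first by split=> // /esym.
have -> : (X `\ x) `\ y = (X `\ y) `\ x.
  by apply/seteqP; split=> z [[Xz zx] zy]; split.
by apply: IH => //; split.
Qed.

Section OrderingToPartition.
Variables (K : fieldType) (n : nat) (G : rel 'I_n) (S : 'I_n -> 'I_n -> {fset K}).
Hypotheses (G_simple : simple_graph G) (S_gain : gain_sets G S) (G_block : is_block G).
Implicit Types (i j u c : 'I_n) (a b : K) (m k : nat) (B : set (set 'rV[K]_n)).

Variable pos : 'I_n -> nat.
Hypothesis pos_lt : forall x, (pos x < n)%N.
Hypothesis pos_inj : injective pos.
Hypothesis pos_onto : forall m, (m < n)%N -> exists x, pos x = m.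
Hypothesis pos_admissible : forall c i j, (pos c < pos i)%N -> (pos c < pos j)%N ->
  i != j -> admissible_rel S c i j.

Definition first_vertex_part k : set (set 'rV[K]_n) :=
  [set H | exists c j a, [/\ pos c = k, (pos c < pos j)%N, a \in S c j & H = gain_hyperplane c j a]].

Let pi (k : 'I_n.-1) := first_vertex_part k.

Let lt_neq c j : (pos c < pos j)%N -> c != j.
Proof. by apply: contraTneq => ->; rewrite ltnn. Qed.

Lemma first_vertex_part_mem k H : first_vertex_part k H -> gain_arrangement S H.
Proof.
by move=> [c [j [a [_ cj aS ->]]]]; exact: gain_arrangement_mem S_gain _ _ _ (lt_neq cj) aS.
Qed.

Lemma first_vertex_part_ex H : gain_arrangement S H ->
  exists2 k, (k < n.-1)%N & first_vertex_part k H.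
Proof.
move=> /gain_arrangementE [i [j [a [ij aS ->]]]].
have [lt|lt|/pos_inj e] := ltngtP (pos i) (pos j); last by rewrite e eqxx in ij.
  exists (pos i); last by exists i, j, a.
  by have := pos_lt j; lia.
exists (pos j); first by have := pos_lt i; lia.
by exists j, i, (- a); split=> //; [exact: gainN S_gain _ _ _ ij aS|rewrite gain_hyperplaneC].
Qed.

Lemma first_vertex_part_inj k k' H : first_vertex_part k H -> first_vertex_part k' H -> k = k'.
Proof.
move=> [c [j [a [<- cj aS ->]]]] [c' [j' [a' [<- cj' aS' e]]]].
have [] := @gain_hyperplane_sub K n c' j' a' c j a (lt_neq cj') (lt_neq cj); first by rewrite e.
  by case=> -> _ _.
by case=> ec ej _; move: cj cj'; rewrite ec ej; lia.
Qed.

Lemma first_vertex_partition : partition [set: 'I_n.-1] pi (gain_arrangement S).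
Proof.
split.
- apply/seteqP; split=> [H [k _]|H /first_vertex_part_ex [k kn HK]].
    exact: first_vertex_part_mem.
  by exists (Ordinal kn).
- by move=> k k' _ _ [H [Hk Hk']]; apply: val_inj; exact: first_vertex_part_inj Hk Hk'.
- move=> k _; have [c pc] : exists c, pos c = k by apply: pos_onto; have := ltn_ord k; lia.
  have [u cu ecu] : exists2 u, (pos c < pos u)%N & G c u.
    by apply: (later_neighbor G_simple S_gain G_block pos_lt pos_inj pos_onto pos_admissible); rewrite pc.
  have [a aS] := edge_gain G_simple S_gain ecu.
  by exists (gain_hyperplane c u a), c, u, a.
Qed.

(** The hyperplane of a section with the earliest first vertex [c] is the only
    one involving the coordinate [c], so it cuts the intersection of the others
    properly. *)
Lemma first_vertex_independent : independent_partition (gain_arrangement S) pi.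
Proof.
elim=> [|p IH] B [BA cB secB].
  have -> : B = set0 by apply/eqP; rewrite -(card_eq0 (U := nat)) -II0.
  by rewrite /independent_section bigcap_set0 codimT; split=> //; exists 0.
have [H1 B1 _] := eq_cardSP _ _ cB.
have exk : exists k, `[< exists2 H, B H & first_vertex_part k H >].
  by have [k _ Hk] := first_vertex_part_ex (BA _ B1); exists k; apply/asboolP; exists H1.
have [k /asboolP [H0 B0 H0k] kmin] := ex_minnP exk.
have [c [u [a [pc cu aS H0E]]]] := H0k.
have [|[x0 x0B] codimB] := IH (B `\ H0).
  split; [by move=> H [/BA]|exact: card_setD1_II|].
  by move=> i H H' [BH _] [BH' _]; exact: secB.
have later H : (B `\ H0) H -> exists c' j b,
    [/\ (pos c < pos c')%N, (pos c < pos j)%N & H = gain_hyperplane c' j b].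
  move=> [BH HH0]; have [k' kn' Hk'] := first_vertex_part_ex (BA _ BH).
  have kk' : (k < k')%N.
    rewrite ltn_neqAle kmin ?andbT; last by apply/asboolP; exists H.
    apply/eqP => e; apply: HH0; apply: (secB (Ordinal kn')) => //.
    by rewrite /pi /= -e.
  have [c' [j [b [pc' cj' bS ->]]]] := Hk'; exists c', j, b; split=> //; lia.
pose move_c (x : 'rV[K]_n) t : 'rV[K]_n := \row_i (if i == c then t else x 0 i).
have move_in x t : (\bigcap_(H in B `\ H0) H) x -> (\bigcap_(H in B `\ H0) H) (move_c x t).
  move=> xB H BH; have := xB H BH; have [c' [j [b [pc' pj ->]]]] := later H BH.
  by rewrite /gain_hyperplane /= !mxE !(eq_sym _ c) (negPf (lt_neq pc')) (negPf (lt_neq pj)).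
have H0f : H0 = hyperplane_of (fun x : 'rV[K]_n => x 0 c - x 0 u) a by [].
have moved t : move_c x0 t 0 c - move_c x0 t 0 u = t - x0 0 u.
  by rewrite !mxE eqxx eq_sym (negPf (lt_neq cu)).
have capE : \bigcap_(H in B) H = (\bigcap_(H in B `\ H0) H) `&` H0.
  by rewrite (@bigcap_setD1 _ _ H0 id B B0) setIC.
have lf : lin_form (fun x : 'rV[K]_n => x 0 c - x 0 u) by move=> t x y; rewrite !mxE; ring.
have ne : (\bigcap_(H in B `\ H0) H) `&` H0 !=set0.
  exists (move_c x0 (x0 0 u + a)); split; first exact: move_in.
  by rewrite H0f /hyperplane_of /= moved addrC addKr.
split; rewrite capE //; rewrite H0f in ne *.
rewrite codim_cap_hyperplane -?codimB // -?H0f //.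
  apply: affine_closed_bigcap => H /later [c' [j [b [_ _ ->]]]].
  have lf' : lin_form (fun x : 'rV[K]_n => x 0 c' - x 0 j) by move=> t x y; rewrite !mxE; ring.
  exact: affine_closed_hyperplane lf'.
move=> sub; have := sub _ (move_in x0 (x0 0 u + a + 1) x0B).
rewrite H0f /hyperplane_of /= moved => e.
have : x0 0 u + a + 1 - x0 0 u - a = 1 by ring.
by rewrite e subrr => /eqP; rewrite eq_sym oner_eq0.
Qed.

(** Among the hyperplanes containing a flat, those with the latest first vertex
    [c] reduce to one: two neighbours of [c] would give, by admissibility, a
    hyperplane between later vertices. *)
Lemma first_vertex_nice : nice_partition (gain_arrangement S) pi.
Proof.
split; [exact: first_vertex_partition|exact: first_vertex_independent|].
move=> X flX XT; have [H AH XH] := flat_sub_hyperplane flX XT.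
have [[x Xx] _] := flX.
pose P k := `[< exists2 H, first_vertex_part k H & X `<=` H >].
have exk : exists k, P k.
  by have [k _ Hk] := first_vertex_part_ex AH; exists k; apply/asboolP; exists H.
have bound k : P k -> (k <= n)%N.
  by move=> /asboolP [H' [c [j [a [<- _ _ _]]]] _]; exact: ltnW.
have [k /asboolP [H0 H0k XH0] kmax] := ex_maxnP exk bound.
have [c [u [a [pc cu aS H0E]]]] := H0k.
have kn : (k < n.-1)%N by have := pos_lt u; lia.
exists (Ordinal kn); rewrite (_ : _ `&` _ = [set H0]) ?card_set1 //.
apply/seteqP; split=> [H'|H' ->]; last first.
  by split=> //; split=> //; exact: first_vertex_part_mem H0k.
move=> [[c' [j [b [pc' cj bS H'E]]]] [AH' XH']].
have ec : c' = c by apply: pos_inj; rewrite pc pc'.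
rewrite {}ec in pc' cj bS H'E.
have xa : x 0 c - x 0 u = a by have := XH0 x Xx; rewrite H0E.
have xb : x 0 c - x 0 j = b by have := XH' x Xx; rewrite H'E.
have [uj|uj] := eqVneq u j; first by rewrite H'E H0E -xa -xb uj.
have dS : b - a \in S u j by exact: pos_admissible cu cj uj _ _ aS bS.
have Xd : X `<=` gain_hyperplane u j (b - a).
  move=> y Xy; have := XH0 y Xy; have := XH' y Xy; rewrite H0E H'E /gain_hyperplane /= => <- <-.
  by ring.
have [l _ Hl] := first_vertex_part_ex (gain_arrangement_mem S_gain uj dS).
have lk : (l <= k)%N by apply: kmax; apply/asboolP; exists (gain_hyperplane u j (b - a)).
have [c1 [j1 [a1 [pc1 cj1 _ e]]]] := Hl.
have [] := @gain_hyperplane_sub K n c1 j1 a1 u j (b - a) (lt_neq cj1) uj; first by rewrite e.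
  by case=> e1 _ _; move: cu lk; rewrite e1 pc1 pc; lia.
by case=> _ e1 _; move: cj lk; rewrite e1 pc1 pc; lia.
Qed.

End OrderingToPartition.

(** * Edge colourings without rainbow closed walks *)

Section Colouring.
Variables (T : finType) (e : rel T) (D : Type) (col : T -> T -> D).
Hypothesis e_simple : simple_graph e.
Implicit Types (U : {set T}) (c i j k l u v w x y : T) (m p q s t M : nat).

Hypothesis colC : forall i j, e i j -> col i j = col j i.
Hypothesis col_disjoint : forall i j k l, uniq [:: i; j; k; l] -> e i j -> e k l ->
  col i j <> col k l.
Hypothesis col_adjacent : forall i j k, uniq [:: i; j; k] -> e i j -> e j k ->
  col i j = col j k -> e i k /\ col i k <> col i j.
Hypothesis no_rainbow : forall (W : nat -> T) M, (0 < M)%N -> W M = W 0%N ->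
  (forall t, (t < M)%N -> e (W t) (W t.+1)) ->
  (forall s t, (s < t < M)%N -> col (W s) (W s.+1) <> col (W t) (W t.+1)) -> False.

Let e_sym x y : e x y -> e y x.
Proof. by case: e_simple => ->. Qed.

Let e_neq x y : e x y -> x != y.
Proof. by apply: contraTneq => ->; case: e_simple => _ ->. Qed.

(** The edges of one colour form a star; the arrow points from the centre of a
    star with at least two edges to a leaf. *)
Definition star_arrow u v :=
  e u v /\ exists w, [/\ w != v, e u w & col u w = col u v].

(** Otherwise the two stars, whose edges pairwise meet, would contain a triangle
    in one colour. *)
Lemma star_centre_unique u v u' v' :
  star_arrow u v -> star_arrow u' v' -> col u v = col u' v' -> u = u'.
Proof.
move=> [uv [w [wv uw cw]]] [uv' [w' [wv' uw' cw']]] cc.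
apply/eqP/negP => /negP uu'.
have vw : e v w /\ col v w <> col v u.
  apply: (col_adjacent _ (e_sym uv) uw); last by rewrite (colC (e_sym uv)).
  by rewrite /= !inE negb_or (eq_sym v u) (e_neq uv) (e_neq uw) eq_sym wv.
have meet x z : e u x -> col u x = col u v -> e u' z -> col u' z = col u v ->
    [\/ z = u, z = x | x = u'].
  move=> ux cx uz cz.
  have [->|zu] := eqVneq z u; first by constructor 1.
  have [->|zx] := eqVneq z x; first by constructor 2.
  have [->|xu] := eqVneq x u'; first by constructor 3.
  have un : uniq [:: u; x; u'; z].
    by rewrite /= !inE !negb_or (e_neq ux) uu' (eq_sym u z) zu xu (eq_sym x z) zx (e_neq uz).
  by case: (col_disjoint un ux uz); rewrite cx cz.
have mono : col v w = col u v \/ col w v = col u v.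
  have cv' : col u' v' = col u v by [].
  have cw'' : col u' w' = col u v by rewrite cw'.
  have [wv'u vv'u] := (meet w v' uw cw uv' cv', meet v v' uv erefl uv' cv').
  have [ww'u vw'u] := (meet w w' uw cw uw' cw'', meet v w' uv erefl uw' cw'').
  have [nwv nwv' nuv] : [/\ w <> v, w' <> v' & u <> v] by split; apply/eqP; rewrite ?(e_neq uv).
  by case: vv'u => ?; case: vw'u => ?; case: wv'u => ?; case: ww'u => ?;
    first [left; congruence | right; congruence | exfalso; congruence].
have [evw nvw] := vw; apply: nvw; rewrite -(colC uv).
by case: mono => <- //; rewrite colC.
Qed.

(** Following arrows backwards for ever would produce a directed cycle, whose
    edges belong to stars with different centres: a rainbow closed walk. *)
Lemma star_source U x : x \in U -> exists2 v, v \in U & forall u, u \in U -> ~ star_arrow u v.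
Proof.
move=> xU; apply: contrapT => nosrc.
have /choice [f fP] : forall v, exists u, v \in U -> u \in U /\ star_arrow u v.
  move=> v; have [vU|vU] := boolP (v \in U); last by exists v.
  apply: contrapT => none; apply: nosrc; exists v => // u uU uv; apply: none.
  by exists u.
have iterU y t : y \in U -> iter t f y \in U.
  by move=> yU; elim: t => //= t IH; case: (fP _ IH).
pose P M := (0 < M)%N && `[< exists2 y, y \in U & iter M f y = y >].
have exP : exists M, P M.
  have /loopingP /(_ (fingraph.order f x)) /trajectP [i io eqi] := looping_order f x.
  exists (fingraph.order f x - i)%N; rewrite /P subn_gt0 io; apply/asboolP.
  exists (iter i f x); first exact: iterU.
  by rewrite -iterD subnK // ltnW.
have [M /andP [M0 /asboolP [y yU yM]] Mmin] := ex_minnP exP.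
have arrow t : star_arrow (iter t.+1 f y) (iter t f y).
  by have [] := fP _ (iterU y t yU).
apply: (no_rainbow (W := fun t => iter t f y) M0); first by rewrite yM.
  by move=> t _; apply: e_sym; case: (arrow t).
move=> s t /andP [st tM] cst.
have eqc : iter s.+1 f y = iter t.+1 f y.
  apply: (star_centre_unique (arrow s) (arrow t)).
  have [e1 _] := arrow s; have [e2 _] := arrow t.
  by rewrite (colC e1) (colC e2).
have : (M <= t - s)%N; last by lia.
apply: Mmin; rewrite /P subn_gt0 st; apply/asboolP; exists (iter s.+1 f y); first exact: iterU.
by rewrite -iterD addnS subnK ?(ltnW st) // -eqc.
Qed.

Lemma shortest_walk (E : rel T) a b : connect E a b -> exists m (w : nat -> T),
  [/\ w 0%N = a, w m = b, forall t, (t < m)%N -> E (w t) (w t.+1) &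
    forall p q, (p.+1 < q <= m)%N -> ~ E (w p) (w q)].
Proof.
pose walk m := `[< exists w : nat -> T,
  [/\ w 0%N = a, w m = b & forall t, (t < m)%N -> E (w t) (w t.+1)] >].
move=> /connectP [s0 sE sb]; have exm : exists m, walk m.
  exists (size s0); apply/asboolP; exists (nth a (a :: s0)); split=> //.
    by rewrite sb (last_nth a).
  by move=> t ts; have /pathP /(_ t ts) := sE.
have [m /asboolP [w [w0 wm wE]] mmin] := ex_minnP exm.
exists m, w; split=> // p q /andP [pq qm] Epq.
have : (m <= m - (q - p.+1))%N; last by lia.
apply: mmin; apply/asboolP.
exists (fun t => if (t <= p)%N then w t else w (t + (q - p.+1))%N); split=> //.
  rewrite ifF; last by apply/negbTE; rewrite -ltnNge; lia.
  by rewrite -wm; congr w; lia.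
move=> t tm; case: (ltngtP t p) => tp.
- by apply: wE; lia.
- by rewrite addSn; apply: wE; lia.
- by rewrite tp (_ : (p.+1 + (q - p.+1))%N = q) //; lia.
Qed.

(** A source [v] of the arrows has all its edges in one colour: a shortest walk
    avoiding [v] between two neighbours of [v] joined to it in different colours
    would close up to a rainbow walk through [v], because two consecutive edges
    of one colour give a chord. *)
Lemma monochromatic_vertex U x : x \in U -> block_on e U ->
  exists2 c, c \in U & forall i j, i \in U -> j \in U -> e c i -> e c j -> col c i = col c j.
Proof.
move=> /star_source [v vU src] [_ cU]; exists v => // a b aU bU va vb.
apply: contrapT => nab.
have ab : a != b by apply/eqP => eab; apply: nab; rewrite eab.
have [||m [w [w0 wm wE short]]] := shortest_walk (cU v vU a b _ _).
- by rewrite !inE aU eq_sym (e_neq va).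
- by rewrite !inE bU eq_sym (e_neq vb).
have we t : (t < m)%N -> e (w t) (w t.+1) by move=> /wE /and3P [].
have wU t : (t <= m)%N -> (w t != v) && (w t \in U).
  case: t => [|t] tm; first by rewrite w0 aU eq_sym (e_neq va).
  by have := wE t tm; rewrite /induced /= !inE => /and3P [_ _].
have m0 : (0 < m)%N by case: (m) wm => // wm; rewrite -w0 wm eqxx in ab.
have winj p q : (p < q <= m)%N -> w p != w q.
  move=> /andP [pq qm]; apply/eqP => wpq.
  have [qm'|qm'] := ltnP q m.
    by apply: (short p q.+1); [lia|rewrite wpq; exact: wE].
  have eqm : q = m by lia.
  case: p pq wpq => [|p] pq wpq; first by rewrite -w0 wpq eqm wm eqxx in ab.
  by apply: (short p q); [lia|rewrite -wpq; apply: wE; lia].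
have wv t : (t <= m)%N -> v != w t by move=> /wU /andP [+ _]; rewrite eq_sym.
have wneq p q : (p <= m)%N -> (q <= m)%N -> p != q -> w p != w q.
  move=> pm qm; rewrite neq_ltn => /orP [pq|qp]; first by apply: winj; rewrite pq.
  by rewrite eq_sym; apply: winj; rewrite qp.
have far s t : (s.+1 < t < m)%N -> col (w s) (w s.+1) <> col (w t) (w t.+1).
  move=> /andP [st tm]; apply: col_disjoint; [|apply: we; lia|exact: we].
  by rewrite /= !inE !negb_or !wneq //; lia.
have atv t u : (t < m)%N -> e v u -> w t != u -> w t.+1 != u -> col v u <> col (w t) (w t.+1).
  move=> tm vu wt wt'; apply: col_disjoint => //; last exact: we.
  rewrite /= !inE !negb_or (e_neq vu) (wv t (ltnW tm)) (wv t.+1 tm) !(eq_sym u) wt wt'.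
  by rewrite wneq //; lia.
pose W t := if t is t'.+1 then (if (t' <= m)%N then w t' else v) else v.
have WS t : (t <= m)%N -> W t.+1 = w t by rewrite /W => ->.
have Wend : W m.+2 = v by rewrite /W ltnn.
have W0 : W 0%N = v by [].
apply: (no_rainbow (W := W) (M := m.+2)) => //.
  case=> [|t] tm; first by rewrite WS // w0.
  rewrite WS; last by lia.
  have [tm'|tm'] := ltnP t m; first by rewrite WS //; exact: we.
  by rewrite (_ : t = m) ?Wend ?wm; [exact: e_sym|lia].
have last_arrow z : z \in U -> e z v -> (exists y, [/\ y != v, e z y & col z y = col z v]) -> False.
  by move=> zU zv ex; apply: (src z zU).
case=> [|s] [|t] // /andP [st tm].
  rewrite W0 (WS 0) // w0 (WS t); last by lia.
  have [tm'|tm'] := ltnP t m; last first.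
    by rewrite (_ : t = m) ?Wend ?wm ?(colC (e_sym vb)) //; lia.
  rewrite WS //; have [t0|t0] := posnP t.
    rewrite t0 w0 => cva; apply: (last_arrow a aU (e_sym va)).
    exists (w 1%N); split; first by rewrite eq_sym wv.
      by rewrite -w0; apply: we.
    by rewrite -cva colC.
  by apply: atv => //; rewrite -w0 wneq //; lia.
rewrite (WS s); last by lia.
rewrite (WS s.+1); last by lia.
rewrite (WS t); last by lia.
have [tm'|tm'] := ltnP t m; last first.
  have et : t = m by lia.
  rewrite et Wend wm (colC (e_sym vb)).
  have [sm|sm] := eqVneq s.+1 m.
    rewrite sm wm => cvb; apply: (last_arrow b bU (e_sym vb)).
    have esb : e (w s) b by rewrite -wm -sm; apply: we; lia.
    exists (w s); split; [by rewrite eq_sym wv //; lia|exact: e_sym|].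
    by rewrite -(colC esb) cvb colC.
  by apply: nesym; apply: atv => //; [lia|rewrite -wm wneq //; lia|rewrite -wm wneq //; lia].
rewrite WS //; have [st'|st'] := eqVneq s.+1 t; last by apply: far; lia.
rewrite -st' => cst.
have [|||es _] := @col_adjacent (w s) (w s.+1) (w s.+2) _ _ _ cst.
- by rewrite /= !inE !negb_or !wneq //; lia.
- by apply: we; lia.
- by apply: we; lia.
apply: (short s s.+2); first by lia.
have := wU s; have := wU s.+2; rewrite /induced /= !inE es => -> //; last by lia.
by move=> -> //; lia.
Qed.

End Colouring.

(** * From nice partitions to admissible orderings *)

Section PartitionToOrdering.
Variables (K : fieldType) (n : nat) (G : rel 'I_n) (S : 'I_n -> 'I_n -> {fset K}).
Hypotheses (G_simple : simple_graph G) (S_gain : gain_sets G S).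
Implicit Types (i j k l c : 'I_n) (a b : K) (U : {set 'I_n}).

Let A := gain_arrangement S.

Variables (s : nat) (pi : 'I_s -> set (set 'rV[K]_n)).
Hypothesis pi_nice : nice_partition A pi.

Definition part_of H : option 'I_s := [pick p | `[< pi p H >]].

Lemma part_ofP H : A H -> exists2 p, pi p H & part_of H = Some p.
Proof.
case: pi_nice => -[cov _ _] _ _; rewrite -{1}cov => -[q _ qH].
rewrite /part_of; case: pickP => [p /asboolP pH|none]; first by exists p.
by have := none q; rewrite (asboolT qH).
Qed.

Lemma part_ofE H p : pi p H -> part_of H = Some p.
Proof.
move=> pH; case: pi_nice => -[cov triv _] _ _.
have AH : A H by rewrite -cov; exists p.
have [q qH ->] := part_ofP AH; congr Some.
by apply: triv => //; exists H.
Qed.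

Lemma section_independent p (B : set (set 'rV[K]_n)) : B `<=` A -> (B #= `I_p)%card ->
  (forall H H', B H -> B H' -> part_of H = part_of H' -> H = H') ->
  \bigcap_(H in B) H !=set0 /\ codim (\bigcap_(H in B) H) = p.
Proof.
move=> BA cB inj; case: pi_nice => _ ind _; apply: ind; split=> // q H H' BH BH' Hq Hq'.
by apply: inj; rewrite // (part_ofE Hq) (part_ofE Hq').
Qed.

Lemma indexed_section_independent (F : nat -> set 'rV[K]_n) p :
  (forall t, (t < p)%N -> A (F t)) ->
  (forall t t', (t < t' < p)%N -> part_of (F t) <> part_of (F t')) ->
  \bigcap_(t in `I_p) F t !=set0 /\ codim (\bigcap_(t in `I_p) F t) = p.
Proof.
move=> FA Fneq; have E : \bigcap_(t in `I_p) F t = \bigcap_(H in F @` `I_p) H.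
  by rewrite bigcap_image.
have inj t t' : (t < p)%N -> (t' < p)%N -> part_of (F t) = part_of (F t') -> t = t'.
  move=> tp tp' e; case: (ltngtP t t') => // lt; exfalso.
    by apply: (Fneq t t'); rewrite ?lt.
  by apply: (Fneq t' t); rewrite ?lt.
rewrite E; apply: section_independent.
- by move=> _ [t tp <-]; exact: FA.
- apply: inj_card_eq => t t'; rewrite !inE => tp tp' e; apply: inj => //; by rewrite e.
- by move=> _ _ [t tp <-] [t' tp' <-] e; congr F; exact: inj.
Qed.

(** The hyperplanes of one edge are parallel, so two of them in different parts
    would form a section with empty intersection. *)
Lemma parallel_same_part i j a b : i != j -> a \in S i j -> b \in S i j ->
  part_of (gain_hyperplane i j a) = part_of (gain_hyperplane i j b).
Proof.
move=> ij aS bS; apply: contrapT => ne.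
have Ah (d : K) : d \in S i j -> A (gain_hyperplane i j d).
  exact: gain_arrangement_mem S_gain _ _ _ ij.
pose F t := if t is 0%N then gain_hyperplane i j a else gain_hyperplane i j b.
have [||[x xF] _] := @indexed_section_independent F 2.
- by case=> [|t] _; exact: Ah.
- by move=> t t' lt; have [-> ->] : t = 0%N /\ t' = 1%N by lia.
have xa : x 0 i - x 0 j = a by exact: (xF 0%N).
have xb : x 0 i - x 0 j = b by exact: (xF 1%N).
by apply: ne; rewrite -xa -xb.
Qed.

Definition edge_colour i j : option 'I_s :=
  if [pick a : S i j] is Some a then part_of (gain_hyperplane i j (val a)) else None.

Lemma edge_colourE i j a : i != j -> a \in S i j ->
  part_of (gain_hyperplane i j a) = edge_colour i j.
Proof.
move=> ij aS; rewrite /edge_colour; case: pickP => [b _|/(_ [` aS]%fset) //].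
by apply: parallel_same_part => //; exact: valP.
Qed.

Lemma edge_colourC i j : G i j -> edge_colour i j = edge_colour j i.
Proof.
move=> ij; have [a aS] := edge_gain G_simple S_gain ij; have ne := edge_neq G_simple ij.
rewrite -(edge_colourE ne aS) -(edge_colourE _ (gainN S_gain ne aS)) 1?eq_sym //.
by rewrite gain_hyperplaneC.
Qed.

Lemma nice_flat X : flats A X -> X <> [set: _] ->
  exists p H, [/\ pi p H, A H, X `<=` H &
    forall H', A H' -> X `<=` H' -> part_of H' = part_of H -> H' = H].
Proof.
move=> flX XT; case: pi_nice => _ _ /(_ X flX XT) [p].
move=> /eq_cardSP [H [Hp [AH XH]]]; rewrite II0 card_eq0 => /eqP rest.
exists p, H; split=> // H' AH' XH' e; apply: contrapT => ne.
have [q qH' qE] := part_ofP AH'.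
have H'p : pi p H' by move: e qH'; rewrite qE (part_ofE Hp) => -[->].
have : ((pi p `&` localization A X) `\ H) H' by [].
by rewrite rest.
Qed.

Lemma hyperplane_pair_flat H1 H2 : A H1 -> A H2 -> H1 `&` H2 !=set0 ->
  H1 <> [set: _] -> flats A (H1 `&` H2) /\ H1 `&` H2 <> [set: _].
Proof.
move=> A1 A2 ne T1; split.
  apply: flatI => //; case: ne => x [x1 x2]; apply: flat_hyperplane => //; by exists x.
by move=> e; apply: T1; apply/seteqP; split=> // x _; have [] : (H1 `&` H2) x by rewrite e.
Qed.

Lemma gain_hyperplane_proper i j a : i != j -> gain_hyperplane i j a <> [set: 'rV[K]_n].
Proof.
move=> ij e; have := I : [set: 'rV[K]_n] (\row_x (if x == i then a + 1 else 0)).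
rewrite -e /gain_hyperplane /= !mxE eqxx eq_sym (negPf ij) subr0 => /eqP.
by rewrite -subr_eq0 addrC addKr oner_eq0.
Qed.

(** On the flat where two disjoint edges meet there are no other hyperplanes, so
    if they had one colour no part would meet its localization once. *)
Lemma disjoint_edges_colour i j k l : uniq [:: i; j; k; l] -> G i j -> G k l ->
  edge_colour i j <> edge_colour k l.
Proof.
move=> un ij kl cc; have [a aS] := edge_gain G_simple S_gain ij.
have [b bS] := edge_gain G_simple S_gain kl.
have [nij nkl] := (edge_neq G_simple ij, edge_neq G_simple kl).
set H1 := gain_hyperplane i j a; set H2 := gain_hyperplane k l b.
have A1 : A H1 by exact: gain_arrangement_mem S_gain _ _ _ nij aS.
have A2 : A H2 by exact: gain_arrangement_mem S_gain _ _ _ nkl bS.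
have p12 : part_of H1 = part_of H2 by rewrite /H1 /H2 !edge_colourE.
have := un; rewrite /= !inE !negb_or -!andbA => /and5P [_ ik il jk /andP [jl _]].
have ne : H1 `&` H2 !=set0.
  exists (\row_x (if x == i then a else if x == k then b else 0)).
  rewrite /H1 /H2 /gain_hyperplane /=; split; rewrite /= !mxE !eqxx.
    by rewrite (eq_sym j) (negPf nij) (negPf jk) subr0.
  by rewrite (eq_sym k) (negPf ik) (eq_sym l) (negPf il) (eq_sym l) (negPf nkl) subr0.
have H12 : H1 <> H2.
  move=> e; have [] := @gain_hyperplane_sub K n k l b i j a nkl nij; first by rewrite -/H2 -e.
    by case=> e1; rewrite e1 eqxx in ik.
  by case=> e1; rewrite e1 eqxx in il.
have [fl nT] := hyperplane_pair_flat A1 A2 ne (gain_hyperplane_proper nij).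
have [p [H [pH AH sub uH]]] := nice_flat fl nT.
have [e1 e2] : H1 = H /\ H2 = H.
  by case: (gain_disjoint_above un AH sub) => e; split; apply: uH => //; rewrite e // p12.
by apply: H12; rewrite e1.
Qed.

(** For adjacent edges of one colour, the only hyperplane that can be alone in
    its part is the one closing the triangle, which therefore belongs to the
    arrangement and to another part. *)
Lemma adjacent_edges_colour i j k : uniq [:: i; j; k] -> G i j -> G j k ->
  edge_colour i j = edge_colour j k ->
  (forall a b, a \in S i j -> b \in S j k -> a + b \in S i k) /\
  edge_colour i k <> edge_colour i j.
Proof.
move=> un ij jk cc; have [nij njk] := (edge_neq G_simple ij, edge_neq G_simple jk).
have nik : i != k by move: un; rewrite /= !inE !negb_or => /andP [/andP [_ ->]].
have key a b : a \in S i j -> b \in S j k ->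
    a + b \in S i k /\ edge_colour i k <> edge_colour i j.
  move=> aS bS; set H1 := gain_hyperplane i j a; set H2 := gain_hyperplane j k b.
  have A1 : A H1 by exact: gain_arrangement_mem S_gain _ _ _ nij aS.
  have A2 : A H2 by exact: gain_arrangement_mem S_gain _ _ _ njk bS.
  have p12 : part_of H1 = part_of H2 by rewrite /H1 /H2 !edge_colourE.
  have ne : H1 `&` H2 !=set0.
    exists (\row_x (if x == i then a + b else if x == j then b else 0)).
    rewrite /H1 /H2 /gain_hyperplane /=; split; rewrite /= !mxE !eqxx.
      by rewrite (eq_sym j) (negPf nij) addrK.
    by rewrite (eq_sym j) (negPf nij) (eq_sym k) (negPf nik) (eq_sym k) (negPf njk) subr0.
  have H12 : H1 <> H2.
    move=> e; have [] := @gain_hyperplane_sub K n j k b i j a njk nij; first by rewrite -/H2 -e.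
      by case=> e1; rewrite e1 eqxx in nij.
    by case=> e1; rewrite e1 eqxx in nik.
  have [fl nT] := hyperplane_pair_flat A1 A2 ne (gain_hyperplane_proper nij).
  have [p [H [pH AH sub uH]]] := nice_flat fl nT.
  have [n1 n2] : H <> H1 /\ H <> H2.
    split=> e; apply: H12.
      have e2 : H2 = H by apply: uH => //; rewrite e p12.
      by rewrite -e e2.
    have e1 : H1 = H by apply: uH => //; rewrite e p12.
    by rewrite -e e1.
  case: (gain_adjacent_above S_gain un AH sub) => // -[abS e]; split=> // cik.
  apply: n1; apply/esym; apply: uH => //.
  by rewrite e /H1 !edge_colourE.
split; first by move=> a b aS bS; case: (key a b aS bS).
have [a aS] := edge_gain G_simple S_gain ij; have [b bS] := edge_gain G_simple S_gain jk.
by case: (key a b aS bS).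
Qed.

Lemma adjacent_edges_chord i j k : uniq [:: i; j; k] -> G i j -> G j k ->
  edge_colour i j = edge_colour j k -> G i k /\ edge_colour i k <> edge_colour i j.
Proof.
move=> un ij jk cc; have [sumS nc] := adjacent_edges_colour un ij jk cc; split=> //.
have [a aS] := edge_gain G_simple S_gain ij; have [b bS] := edge_gain G_simple S_gain jk.
apply: (gain_edge S_gain _ (sumS a b aS bS)).
by move: un; rewrite /= !inE !negb_or => /andP [/andP [_ ->]].
Qed.

(** The equations along a closed walk are dependent, so they cannot be the
    equations of an independent section. *)
Lemma no_rainbow_walk (W : nat -> 'I_n) M : (0 < M)%N -> W M = W 0%N ->
  (forall t, (t < M)%N -> G (W t) (W t.+1)) ->
  (forall t t', (t < t' < M)%N ->
     edge_colour (W t) (W t.+1) <> edge_colour (W t') (W t'.+1)) -> False.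
Proof.
case: M => // M _ WM WG Wcol.
have /choice [g gS] : forall t, exists a, (t < M.+1)%N -> a \in S (W t) (W t.+1).
  move=> t; have [tM|tM] := ltnP t M.+1; last by exists 0.
  by have [a aS] := edge_gain G_simple S_gain (WG t tM); exists a.
pose F t := gain_hyperplane (W t) (W t.+1) (g t).
have Wne t : (t < M.+1)%N -> W t != W t.+1 by move=> /WG; exact: edge_neq.
have FA t : (t < M.+1)%N -> A (F t).
  by move=> tM; exact: gain_arrangement_mem S_gain _ _ _ (Wne t tM) (gS t tM).
have Fcol t t' : (t < t' < M.+1)%N -> part_of (F t) <> part_of (F t').
  move=> /andP [tt' tM']; have tM : (t < M.+1)%N by lia.
  rewrite /F (edge_colourE (Wne t tM) (gS t tM)) (edge_colourE (Wne t' tM') (gS t' tM')).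
  by apply: Wcol; rewrite tt'.
have [[x0 x0F] codimM] := indexed_section_independent FA Fcol.
have [_ codimM'] := @indexed_section_independent F M
  (fun t tM => FA t (ltnW tM)) (fun t t' h => Fcol t t' ltac:(lia)).
have tele x m : (forall t, (t < m)%N -> F t x) ->
    x 0 (W 0%N) - x 0 (W m) = \sum_(t < m) g t.
  elim: m => [|m IH] xF; first by rewrite big_ord0 subrr.
  rewrite big_ord_recr /= -IH; last by move=> t tm; apply: xF; exact: ltnW.
  by rewrite -(xF m) //; ring.
have E : \bigcap_(t in `I_M.+1) F t = \bigcap_(t in `I_M) F t.
  apply/seteqP; split=> x xF t tM; first by apply: xF; exact: ltnW tM.
  have [tM'|tM'] := ltnP t M; first exact: xF.
  have -> : t = M by move: tM => /=; lia.
  have e1 := tele x M (fun t h => xF t h).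
  have e0 := tele x0 M (fun t h => x0F t (ltnW h)).
  have eM : F M x0 by apply: x0F => /=.
  move: eM; rewrite /F /gain_hyperplane /= WM => <-.
  by rewrite -[LHS]opprB e1 -e0 opprB.
by move: codimM; rewrite E codimM' => /eqP; lia.
Qed.

Lemma nice_elimination U : block_on G U ->
  exists t : seq 'I_n, [/\ uniq t, t =i U & elimination (admissible_rel S) t].
Proof.
move sz : #|U| => m; elim: m U sz => [|m IH] U sz bU.
  by exists [::]; split=> // x; rewrite (cards0_eq sz) finset.in_set0.
have [x xU] : exists x, x \in U by apply/finset.set0Pn; rewrite -card_gt0 sz.
have [c cU mono] := monochromatic_vertex G_simple edge_colourC disjoint_edges_colour
  adjacent_edges_chord no_rainbow_walk xU bU.
have G_sym i j : G i j -> G j i by case: G_simple => ->.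
have uniq3 i j : i != j -> G c i -> G c j -> uniq [:: i; c; j].
  move=> ij ci cj; rewrite /= !inE negb_or ij (edge_neq G_simple cj).
  by rewrite (edge_neq G_simple (G_sym _ _ ci)).
have same i j : i \in U -> j \in U -> G c i -> G c j -> edge_colour i c = edge_colour c j.
  by move=> iU jU ci cj; rewrite -(edge_colourC ci); exact: mono.
have sc : simplicial G c U.
  move=> i j iU jU ij ci cj.
  by have [] := adjacent_edges_chord (uniq3 _ _ ij ci cj) (G_sym _ _ ci) cj (same _ _ iU jU ci cj).
have szc : #|U :\ c| = m by move: sz; rewrite (cardsD1 c U) cU => -[].
have [t [ut tU et]] := IH (U :\ c) szc (block_on_remove G_simple bU cU sc).
exists (c :: t); split.
- by rewrite /= ut tU !inE eqxx.
- by move=> y; rewrite inE tU !inE; have [->|] := eqVneq y c; rewrite ?cU.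
split=> // i j; rewrite !tU !inE => /andP [ic iU] /andP [jc jU] ij a b aS bS.
have [ci cj] : c != i /\ c != j by rewrite !(eq_sym c).
have [Gci Gcj] := (gain_edge S_gain ci aS, gain_edge S_gain cj bS).
have [sumS _] := adjacent_edges_colour (uniq3 _ _ ij Gci Gcj) (G_sym _ _ Gci) Gcj (same _ _ iU jU Gci Gcj).
by rewrite addrC; apply: sumS => //; exact: gainN S_gain _ _ _ ci aS.
Qed.

End PartitionToOrdering.

(** * The equivalence *)

Section Orderings.
Variables (K : fieldType) (n : nat) (S : 'I_n -> 'I_n -> {fset K}).

Lemma elimination_nth (R : 'I_n -> 'I_n -> 'I_n -> Prop) s x0 k p q : elimination R s ->
  (k < p < size s)%N -> (k < q < size s)%N -> nth x0 s p != nth x0 s q ->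
  R (nth x0 s k) (nth x0 s p) (nth x0 s q).
Proof.
elim: s k p q => [|c s IH] k p q; first by rewrite ltn0 andbF.
case: p q => [|p] [|q] //; case: k => [|k] /= [Rc Rs]; last exact: IH.
by move=> ps qs ne; apply: Rc => //; apply: mem_nth.
Qed.

Lemma elimination_ordering s : uniq s -> s =i [set: 'I_n]%SET ->
  elimination (admissible_rel S) s -> exists v : {perm 'I_n}, admissible_ordering S v.
Proof.
move=> us sT es; have szs : size s = n.
  by rewrite -(card_uniqP us) (eq_card sT) cardsT card_ord.
have ks (k : 'I_n) : (k < size s)%N by rewrite szs.
pose f (k : 'I_n) := nth k s k.
have fE x (k : 'I_n) : f k = nth x s k by apply: set_nth_default.
have finj : injective f.
  move=> k l; rewrite (fE k l) (fE k k) => /eqP; rewrite nth_uniq // => /eqP.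
  exact: val_inj.
exists (perm finj) => k i j ki kj ij; apply/fsubsetP => d /imfset2P [b bS [a aS ->]].
move: bS aS; rewrite /= !permE => bS aS.
rewrite (fE k i) (fE k j) in bS aS *.
apply: (elimination_nth (x0 := k) es) aS bS; rewrite ?ki ?kj ?ks //.
by rewrite nth_uniq.
Qed.

Lemma ordering_position (v : {perm 'I_n}) : admissible_ordering S v ->
  let pos x := val ((v^-1)%g x) in
  [/\ forall x, (pos x < n)%N, injective pos, forall m, (m < n)%N -> exists x, pos x = m &
    forall c i j, (pos c < pos i)%N -> (pos c < pos j)%N -> i != j -> admissible_rel S c i j].
Proof.
move=> adm pos; split=> [x|x y /val_inj /perm_inj //|m mn|c i j ci cj ij a b aS bS].
- exact: ltn_ord.
- by exists (v (Ordinal mn)); rewrite /pos permK.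
have ij' : (v^-1)%g i != (v^-1)%g j by rewrite (inj_eq perm_inj).
have := adm ((v^-1)%g c) ((v^-1)%g i) ((v^-1)%g j) ci cj ij'.
rewrite !permKV => /fsubsetP; apply; apply/imfset2P.
by exists b => //; exists a.
Qed.

End Orderings.

Theorem theorem1p1 (K : fieldType) (n : nat) (G : rel 'I_n)
    (S : 'I_n -> 'I_n -> {fset K})
    (G_simple : simple_graph G)
    (S_gain : gain_sets G S)
    (G_block : is_block G) :
  [<-> supersolvable (cone_arrangement S);
       exists r C, maximal_modular_chain (cone_arrangement S) r C /\
                   chain_through r C hyperplane_at_infinity;
       exists (s : nat) (pi : 'I_s -> set (set 'rV[K]_n)),
         nice_partition (gain_arrangement S) pi;
       exists v : {perm 'I_n}, admissible_ordering S v].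
Proof.
have blockT := block_onT G_block.
have linA := @cone_linear K n S.
have chain_ordering r C : maximal_modular_chain (cone_arrangement S) r C ->
    exists v : {perm 'I_n}, admissible_ordering S v.
  move=> mmC; have [chC _] := mmC; have [C0 Cr _ decC _] := chC.
  have dec k : (k < r)%N -> C k.+1 `<=` C k by move=> /decC /properW.
  have [||s [us sT es]] := admissible_elimination G_simple S_gain C0 dec
    (fun k H1 H2 => modular_chain_exchange linA mmC) (leqnn r) blockT.
  - by rewrite Cr; apply: bigcap_inf; right.
  - move=> i j a _ _ ij aS; rewrite Cr; apply: bigcap_inf.
    exact: cone_arrangement_mem S_gain _ _ _ ij aS.
  exact: elimination_ordering us sT es.
have ordering_chain (v : {perm 'I_n}) : admissible_ordering S v ->
    exists r C, maximal_modular_chain (cone_arrangement S) r C /\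
                chain_through r C hyperplane_at_infinity.
  move=> /ordering_position [lt inj onto adm].
  have mmC := tail_chain_maximal_modular G_simple S_gain G_block lt inj onto adm.
  by eexists; eexists; exact: mmC.
tfae.
- by move=> [_ [r [C /chain_ordering [v /ordering_chain]]]].
- move=> [r [C [/chain_ordering [v /ordering_position [lt inj onto adm]] _]]].
  have nice := first_vertex_nice G_simple S_gain G_block lt inj onto adm.
  by eexists; eexists; exact: nice.
- move=> [s [pi nice]].
  have [t [ut tT et]] := nice_elimination G_simple S_gain nice blockT.
  exact: elimination_ordering ut tT et.
move=> [v /ordering_chain [r [C [mmC _]]]]; split; last by exists r, C.
by exists 0 => H AH; exact: hyperplane_contains0 linA _ AH.
Qed.
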